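(* Consider Non-IID Stochastic AdWords as in the context, and a fractional allocation $\mu^t_{ij}\ge0$ (for $t\in[T]$, $i\in I$, $j\in J$) such that $x^t_{ij}=f^t_i\mu^t_{ij}$ is a feasible solution of the Stochastic AdWords LP. Run the General SOCS for AdWords with this fractional allocation. For an agent $j$, let $y_j=\sum_t\sum_if^t_i\mu^t_{ij}b_{ij}/B_j$ and let $A_j$ be the total bid $b_{ij}$ of the items allocated to $j$. Then for every agent $j$, $$\mathbf{E}\Big[\Big(1-\frac{A_j}{B_j}\Big)^+\Big]\le g(y_j):=e^{-y_j}\Big(\frac34+\frac14\cdot\frac{1+(y_j-0.417)^+/4}{e^{(y_j-0.417)^+/4}}\Big)^2,$$ where the expectation is over the realized types and the algorithm's randomness.
   Context: Non-IID Stochastic AdWords: types $I$, agents $J$, $T$ steps; at each step $t$ independently an item of type $i$ arrives with probability $f^t_i$ ($\sum_if^t_i\le1$, otherwise no arrival); the algorithm observes the realized type and must allocate the item immediately. Agent $j$ has budget $B_j>0$ and bids $b_{ij}\ge0$ with $b_{ij}\le B_j$. Let $R^t_i$ indicate that the item at step $t$ has type $i$, and $\bar v_j(S)=\mathbf{E}[\min\{\sum_{(t,i)\in S}R^t_ib_{ij},B_j\}]$ for $S\subseteq[T]\times I$. Stochastic AdWords LP constraints: $\sum_jx^t_{ij}\le f^t_i$ for all $i,t$; $\sum_{(t,i)\in S}b_{ij}x^t_{ij}\le\bar v_j(S)$ for all $j$ and $S\subseteq[T]\times I$; $x\ge0$. Type Decomposition (type $i$ at step $t$): place in $[0,1)$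 consecutive left-closed right-open intervals $I_j$ of lengths $\mu^t_{ij}$ in a fixed order of $j$, leftover $I_\perp$ for a dummy agent $\perp$ with zero bids; sample $\eta$ uniform in $[0,\frac12)$, $\eta'=\eta+\frac12$, $\eta\in I_j$, $\eta'\in I_k$; output one-way type $i\sim j$ if $j=k$, else two-way type $i\sim\{j,k\}$. Two-Way SOCS for AdWords (stateful): on two-way type $i\sim\{j,k\}$: pick $m\in\{j,k\}$ uniformly; if $b_{im}\ge\frac23B_m$ mark step with $m$; if this is the second step marked with $m$, select opposite w.r.t. $m$ to the first marked step (select $m$ iff $m$ was not selected there); else select $j$ or $k$ uniformly. General SOCS for AdWords: each step draw a surrogate type by Type Decomposition (fresh randomness); allocate to $j$ for $i\sim j$; for $i\sim\{j,k\}$ allocate to the agent selected by the Two-Way SOCS. *)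

(* Defs.v *)
From HB Require Import structures.
From mathcomp Require Import all_boot all_order all_algebra.
From mathcomp Require Import all_classical all_reals all_analysis.

Set Implicit Arguments.
Unset Strict Implicit.
Unset Printing Implicit Defensive.

Import Order.TTheory GRing.Theory Num.Theory.
Import numFieldNormedType.Exports.

Local Open Scope classical_set_scope.
Local Open Scope ring_scope.

Definition half_interval {R : realType} : set R := `[0, 2^-1[%classic.

Record adwords (R : realType) (I J : finType) (T : nat) := Adwords {
  arrival_rate : 'I_T -> I -> R;
  budget : J -> R;
  bid : I -> J -> R;
  arrival_rate_ge0 : forall t i, 0 <= arrival_rate t i;
  arrival_rate_sum : forall t, \sum_i arrival_rate t i <= 1;
  budget_gt0 : forall j, 0 < budget j;
  bid_ge0 : forall i j, 0 <= bid i j;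
  bid_le_budget : forall i j, bid i j <= budget j }.

(* All the randomness of a run.  At step t: the arriving type (None if there is
   no arrival), the uniform sample eta of Type Decomposition, and two fair
   coins used by Two-Way SOCS, one for the choice of m and one for the uniform
   selection.  Drawing the coins at every step, needed or not, does not change
   the law of the run. *)
Record randomness (R : realType) (I J : finType) (T : nat)
    (W : adwords R I J T) (d : measure_display) (Omega : measurableType d)
    (P : probability Omega R) := Randomness {
  arrival : 'I_T -> Omega -> option I;
  eta : 'I_T -> {RV P >-> R};
  mark_coin : 'I_T -> {RV P >-> bool};
  select_coin : 'I_T -> {RV P >-> bool};
  arrival_measurable :
    forall t (U : set (option I)), measurable (arrival t @^-1` U);
  arrival_law : forall t i,
    P [set w | arrival t w = Some i] = (arrival_rate W t i)%:E;
  eta_law : forall t (V : set R), measurable V ->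
    P (eta t @^-1` V) = (2%:E * lebesgue_measure (V `&` half_interval))%E;
  mark_coin_law : forall t, P [set w | mark_coin t w = true] = (2^-1)%:E;
  select_coin_law : forall t, P [set w | select_coin t w = true] = (2^-1)%:E;
  (* Mutual independence of all 4T variables: the product rule for
     subfamilies is the case where the other sets are full. *)
  randomness_independent :
    forall (U : 'I_T -> set (option I)) (V : 'I_T -> set R)
           (C D : 'I_T -> set bool),
      (forall t, measurable (V t)) ->
      P (\bigcap_(t in [set: 'I_T])
           (arrival t @^-1` U t `&` eta t @^-1` V t
            `&` mark_coin t @^-1` C t `&` select_coin t @^-1` D t))
      = (\prod_(t < T)
           (P (arrival t @^-1` U t) * P (eta t @^-1` V t)
            * P (mark_coin t @^-1` C t) * P (select_coin t @^-1` D t)))%E }.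

(* R^t_i *)
Definition arrives (R : realType) (I J : finType) (T : nat)
    (W : adwords R I J T) (d : measure_display) (Omega : measurableType d)
    (P : probability Omega R) (rnd : randomness W P)
    (t : 'I_T) (i : I) (w : Omega) : R :=
  (arrival rnd t w == Some i)%:R.

Definition capped_bid (R : realType) (I J : finType) (T : nat)
    (W : adwords R I J T) (d : measure_display) (Omega : measurableType d)
    (P : probability Omega R) (rnd : randomness W P)
    (j : J) (S : {set 'I_T * I}) (w : Omega) : R :=
  Num.min (\sum_(ti in S) arrives rnd ti.1 ti.2 w * bid W ti.2 j) (budget W j).

(* \bar v_j(S) *)
Definition expected_value (R : realType) (I J : finType) (T : nat)
    (W : adwords R I J T) (d : measure_display) (Omega : measurableType d)
    (P : probability Omega R) (rnd : randomness W P)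
    (j : J) (S : {set 'I_T * I}) : \bar R :=
  'E_P[capped_bid rnd j S]%E.

Definition lp_feasible (R : realType) (I J : finType) (T : nat)
    (W : adwords R I J T) (d : measure_display) (Omega : measurableType d)
    (P : probability Omega R) (rnd : randomness W P)
    (x : 'I_T -> I -> J -> R) : Prop :=
  [/\ forall t i, \sum_j x t i j <= arrival_rate W t i,
      forall j (S : {set 'I_T * I}),
        ((\sum_(ti in S) bid W ti.2 j * x ti.1 ti.2 j)%:E
           <= expected_value rnd j S)%E
    & forall t i j, 0 <= x t i j].

(* Agents together with the dummy agent None, which has zero bids.  Its budget
   is an arbitrary positive number, so that it is never marked. *)
Notation agent J := (option J) (only parsing).

Definition xbid (R : realType) (I J : finType) (T : nat)
    (W : adwords R I J T) (i : I) (a : agent J) : R :=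
  if a is Some j then bid W i j else 0.

Definition xbudget (R : realType) (I J : finType) (T : nat)
    (W : adwords R I J T) (a : agent J) : R :=
  if a is Some j then budget W j else 1.

Inductive surrogate (I J : Type) :=
| OneWay of I & agent J
| TwoWay of I & agent J & agent J.

Section TypeDecomposition.
Context (R : realType) (I J : finType) (T : nat).
(* The fixed order of the agents, as a duplicate-free list of all of them. *)
Context (ord : seq J) (mu : 'I_T -> I -> J -> R).

Definition left_end (t : 'I_T) (i : I) (j : J) : R :=
  \sum_(j' <- take (index j ord) ord) mu t i j'.

Definition agent_interval (t : 'I_T) (i : I) (j : J) : interval R :=
  `[left_end t i j, left_end t i j + mu t i j[.

(* The agent whose interval contains e, the dummy agent if there is none. *)
Definition agent_at (t : 'I_T) (i : I) (e : R) : agent J :=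
  [pick j | e \in agent_interval t i j].

Definition decompose (t : 'I_T) (i : I) (e : R) : surrogate I J :=
  let a := agent_at t i e in
  let a' := agent_at t i (e + 2^-1) in
  if a == a' then OneWay i a else TwoWay i a a'.

End TypeDecomposition.

(* What is recorded of a step with an arrival: the realized type, the marking
   agent (if any) and the selected agent. *)
Record event (I J : Type) := Event {
  item : I;
  mark : option (agent J);
  selected : agent J }.

Section SOCS.
Context (R : realType) (I J : finType) (T : nat) (W : adwords R I J T).

(* The agents selected at the steps marked with m, in chronological order. *)
Definition marked_selections (h : seq (event I J)) (m : agent J) :
    seq (agent J) :=
  [seq selected e | e <- h & mark e == Some m].

Definition two_way_socs (h : seq (event I J)) (i : I) (a a' : agent J)
    (mcoin scoin : bool) : event I J :=
  let m := if mcoin then a else a' in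
  let m' := if mcoin then a' else a in
  let u := if scoin then a else a' in
  if 2 / 3 * xbudget W m <= xbid W i m then
    Event i (Some m)
      (if marked_selections h m is [:: s] then (if s == m then m' else m)
       else u)
  else Event i None u.

Definition socs_step (h : seq (event I J)) (s : surrogate I J)
    (mcoin scoin : bool) : event I J :=
  match s with
  | OneWay i a => Event i None a
  | TwoWay i a a' => two_way_socs h i a a' mcoin scoin
  end.

Context (d : measure_display) (Omega : measurableType d)
  (P : probability Omega R) (rnd : randomness W P).
Context (ord : seq J) (mu : 'I_T -> I -> J -> R).

Definition general_socs (w : Omega) : seq (event I J) :=
  foldl (fun h t =>
    if arrival rnd t w is Some i then
      rcons h (socs_step h (decompose ord mu t i (eta rnd t w))
                 (mark_coin rnd t w) (select_coin rnd t w))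
    else h) [::] (enum 'I_T).

(* A_j *)
Definition allocated_bid (j : J) (w : Omega) : R :=
  \sum_(e <- general_socs w | selected e == Some j) bid W (item e) j.

End SOCS.

(* y_j *)
Definition load (R : realType) (I J : finType) (T : nat)
    (W : adwords R I J T) (mu : 'I_T -> I -> J -> R) (j : J) : R :=
  \sum_(t < T) \sum_i arrival_rate W t i * mu t i j * bid W i j / budget W j.

Definition pos_part (R : realType) (z : R) : R := Num.max z 0.

Definition g (R : realType) (y : R) : R :=
  let z := pos_part (y - 417 / 1000) / 4 in
  expR (- y) * (3 / 4 + 1 / 4 * ((1 + z) / expR z)) ^+ 2.

(* Main.v *)
Require Import Defs.
From HB Require Import structures.
From mathcomp Require Import all_boot all_order all_algebra.
From mathcomp Require Import all_classical all_reals all_analysis.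
From mathcomp Require Import measurable_realfun ring lra.

Set Implicit Arguments.
Unset Strict Implicit.
Unset Printing Implicit Defensive.

Import Order.TTheory GRing.Theory Num.Theory.
Import numFieldNormedType.Exports.

Local Open Scope classical_set_scope.
Local Open Scope ring_scope.

(** The shortfall of agent [j] is a convex function of the bids it wins, so it is
    at most what it would be if every correlation between steps marked by other
    agents were replaced by independent fair coins: the two selections of a
    correlated pair never favour [j] twice.  From there (1 - sum a)^+ <= prod (1 - a)
    gives [expR (- y)], and there are two sources of improvement.  The two selections
    correlated through the marks of [j] itself turn the product (1 - b/2)(1 - b'/2)
    into 1 - (b + b')/2.  A bid below 2/3 may be replaced by a bid of exactly 2/3
    with the same mean, and two selected bids of 2/3 already exhaust the budget.
    Each source gains about R^2/2, where R is half the load of [j] due to two-way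
    types with large bids, respectively to small bids.  Only one-way types with
    large bids bring no gain, and the LP constraint on the pairs (t, i) with a
    large bid and mu > 1/2 bounds their load by 0.417, unless some steps carry so
    much load that prod (1 - y_t) is already well below [expR (- y)].  Since the
    load is at most 1, the better of the two gains suffices: the claimed bound is at
    least [expR (- y) * (1 - ((y - 0.417)^+)^2 / 64)]. *)

(** * Exponential estimates *)

Section RealInequalities.
Context {R : realType}.
Implicit Types x y z : R.

Lemma mean_value_at0 (f f' : R -> R) x :
  (forall z, is_derive z 1 f (f' z)) ->
  exists2 c, (0 <= c <= x) || (x <= c <= 0) & f x - f 0 = f' c * x.
Proof.
move=> df.
have cf : continuous f.
  by move=> z; apply: differentiable_continuous; apply/derivable1_diffP;
     apply: ex_derive.
have cfw (a b : R) : {within `[a, b], continuous f}.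
  by apply: continuous_subspaceT => z; exact: cf.
case: (leP 0 x) => x0.
  have [c + e] := MVT_segment x0 (fun z _ => df z) (cfw _ _).
  by rewrite in_itv/= => cx; exists c; rewrite ?cx// e subr0.
have [c + e] := MVT_segment (ltW x0) (fun z _ => df z) (cfw _ _).
rewrite in_itv/= => cx; exists c; rewrite ?cx ?orbT//.
by rewrite -[LHS]opprB e sub0r mulrN opprK.
Qed.

Lemma expR_ge_taylor3 x : 1 + x + x ^+ 2 / 2 + x ^+ 3 / 6 <= expR x.
Proof.
have taylor2 z : 0 <= (expR z - 1 - z - z ^+ 2 / 2) * z.
  have [|c _] := @mean_value_at0 (fun z => expR z - z - z ^+ 2 / 2)
    (fun z => expR z - 1 - z) z.
    by move=> u; apply: is_derive_eq; rewrite /GRing.scale/= ; field.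
  rewrite expR0 expr0n/= mul0r => e; have h := expR_ge1Dx c.
  have -> : expR z - 1 - z - z ^+ 2 / 2 = (expR c - 1 - c) * z.
    by rewrite -e; ring.
  by rewrite -mulrA -expr2 mulr_ge0 ?sqr_ge0//; lra.
have [|c cx] := @mean_value_at0 (fun z => expR z - z - z ^+ 2 / 2 - z ^+ 3 / 6)
    (fun z => expR z - 1 - z - z ^+ 2 / 2) x.
  by move=> u; apply: is_derive_eq; rewrite /GRing.scale/= ; field.
rewrite expR0 !expr0n/= !mul0r => e.
suff: 0 <= (expR c - 1 - c - c ^+ 2 / 2) * x by rewrite -e; lra.
have := taylor2 c; set u := expR c - _ - _ - _ => uc.
have [c00|c0] := eqVneq c 0; first by rewrite /u c00 expR0 expr0n/= mul0r !subr0 subrr mul0r.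
case/orP : cx => /andP[c1 c2].
  have cp : 0 < c by rewrite lt_neqAle eq_sym c0.
  by rewrite pmulr_lge0// in uc; rewrite mulr_ge0// (le_trans c1).
have cn : c < 0 by rewrite lt_neqAle c0.
by rewrite nmulr_lge0// in uc; rewrite mulr_le0// (le_trans c1).
Qed.

Lemma onem_le_expR y : 0 <= y <= 1 -> 1 - y <= expR (- (y + y ^+ 2 / 2)).
Proof.
move=> /andP[y0 y1]; apply: le_trans (expR_ge_taylor3 _).
have y2 : 0 <= y ^+ 2 <= y ^+ 1 by rewrite exprn_ge0// ler_wiXn2l.
have y4 : 0 <= y ^+ 4 <= y ^+ 3 by rewrite exprn_ge0// ler_wiXn2l.
have y5 : 0 <= y ^+ 5 <= y ^+ 3 by rewrite exprn_ge0// ler_wiXn2l.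
have y6 : 0 <= y ^+ 6 <= y ^+ 3 by rewrite exprn_ge0// ler_wiXn2l.
rewrite -subr_ge0.
set e := (X in 0 <= X).
have -> : e = y ^+ 3 / 3 - y ^+ 4 / 8 - y ^+ 5 / 8 - y ^+ 6 / 48.
  by rewrite /e; field.
lra.
Qed.

Lemma onem_ge_expR x : 0 <= x <= 39 / 125 ->
  expR (- (x + 2 / 3 * x ^+ 2)) <= 1 - x.
Proof.
move=> /andP[x0 x1]; rewrite expRN invf_ple ?posrE ?expR_gt0//; last by lra.
apply: le_trans (expR_ge_taylor3 _).
rewrite -[leLHS]mul1r ler_pdivrMr; last by lra.
rewrite -subr_ge0; set z := (X in 0 <= X).
have -> : z = x ^+ 2 * (1 / 6 - x / 3 - 5 / 18 * x ^+ 2 - x ^+ 3 / 3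
    - 14 / 81 * x ^+ 4 - 4 / 81 * x ^+ 5).
  by rewrite /z; field.
have xk k c d : x ^+ k <= c -> 39 / 125 * c <= d -> x ^+ k.+1 <= d.
  by move=> kc; apply: le_trans; rewrite exprS ler_pM// exprn_ge0.
have x2 : x ^+ 2 <= 1 / 10 by apply: (xk 1 (39 / 125)); lra.
have x3 : x ^+ 3 <= 1 / 32 by apply: xk x2 _; lra.
have x4 : x ^+ 4 <= 1 / 100 by apply: xk x3 _; lra.
have x5 : x ^+ 5 <= 1 / 300 by apply: xk x4 _; lra.
rewrite mulr_ge0 ?sqr_ge0//; lra.
Qed.

Lemma expRN1146 : 34 / 107 <= expR (- (573 / 500)) :> R.
Proof.
have sq (a b z : R) : 0 <= a -> a <= expR z -> b <= a ^+ 2 -> b <= expR (z + z).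
  by move=> a0 az ba; rewrite expRD -expr2 (le_trans ba)// lerXn2r ?nnegrE ?expR_ge0.
have -> : - (573 / 500) =
    - (573 / 4000) - 573 / 4000 + (- (573 / 4000) - 573 / 4000) +
    (- (573 / 4000) - 573 / 4000 + (- (573 / 4000) - 573 / 4000)) :> R by field.
apply: (sq (146 / 259)); [lra| |lra].
apply: (sq (223 / 297)); [lra| |lra].
apply: (sq (383 / 442)); [lra| |lra].
by apply: le_trans (expR_ge_taylor3 _); lra.
Qed.

Lemma one_way_expR_bound y : 417 / 1000 <= y ->
  2 - 58 / 31 * (expR (- (3 / 2 * y)) * (1 + y / 2)) - y <= 417 / 1000.
Proof.
move=> y0; have [y1|y1] := leP (1583 / 1000) y.
  have : 0 <= expR (- (3 / 2 * y)) * (1 + y / 2).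
    by rewrite mulr_ge0 ?expR_ge0//; lra.
  lra.
set u := 3 / 2 * y - 573 / 500.
have -> : - (3 / 2 * y) = - (573 / 500) + - u by rewrite /u; ring.
rewrite expRD.
have -> : y = 2 / 3 * (u + 573 / 500) by rewrite /u; field.
have u0 : - (53 / 100) <= u by rewrite /u; lra.
have u1 : u <= 123 / 100 by rewrite /u; lra.
have h := expR_ge_taylor3 (- u).
pose q := 1 - u + u ^+ 2 / 2 - u ^+ 3 / 6.
have q0 : 0 <= q by rewrite /q; nra.
have hq : 34 / 107 * q * (1 + (u + 573 / 500) / 3) <=
    expR (- (573 / 500)) * expR (- u) * (1 + (u + 573 / 500) / 3).
  apply: ler_wpM2r; first by lra.
  apply: ler_pM; [lra|exact: q0|exact: expRN1146|].
  by apply: le_trans h; rewrite /q; lra.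
suff : 1583 / 1000 <= 58 / 31 * (34 / 107 * q * (1 + (u + 573 / 500) / 3))
   + 2 / 3 * (u + 573 / 500) by lra.
clear hq h q0; have uu := sqr_ge0 u; rewrite /q.
have [u2|u2] := leP 0 u.
  have u3 : u ^+ 3 <= 5 / 4 * u ^+ 2 by rewrite exprS ler_wpM2r//; lra.
  have u4 : u ^+ 4 <= 5 / 4 * u ^+ 3 by rewrite exprS ler_wpM2r ?exprn_ge0//; lra.
  lra.
have u3 : u ^+ 3 <= 0 by rewrite exprS mulr_le0_ge0// ltW.
have u4 : u ^+ 4 <= 3 / 10 * u ^+ 2.
  by rewrite (exprD u 2 2) ler_wpM2r//; nra.
have ut := sqr_ge0 (u + 53 / 500).
lra.
Qed.

Lemma g_lower_bound y : y <= 1 ->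
  expR (- y) * (1 - pos_part (y - 417 / 1000) ^+ 2 / 64) <= g y.
Proof.
move=> y1; rewrite /g; apply: ler_wpM2l; first exact: expR_ge0.
set p := pos_part _.
have p0 : 0 <= p by rewrite /p/pos_part le_max lexx orbT.
have p1 : p <= 583 / 1000 by rewrite /p/pos_part ge_max; apply/andP; split; lra.
set z := p / 4.
have -> : p ^+ 2 / 64 = z ^+ 2 / 4 by rewrite /z; field.
have z0 : 0 <= z by rewrite /z; lra.
have z1 : z <= 1 by rewrite /z; lra.
have h := expR_ge_taylor3 (- z).
have hx : 1 - z ^+ 2 / 2 <= (1 + z) / expR z.
  rewrite -expRN; apply: (@le_trans _ _ ((1 + z) *
    (1 + - z + (- z) ^+ 2 / 2 + (- z) ^+ 3 / 6))); last first.
    by apply: ler_wpM2l h; lra.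
  rewrite -subr_ge0; set e := (X in 0 <= X).
  have -> : e = z ^+ 3 * (1 / 3 - z / 6) by rewrite /e; field.
  by rewrite mulr_ge0 ?exprn_ge0//; lra.
have z2 : 0 <= z ^+ 2 <= 1 by rewrite exprn_ge0//= exprn_ile1.
apply: (@le_trans _ _ ((1 - z ^+ 2 / 8) ^+ 2)).
  have := sqr_ge0 (z ^+ 2 / 8); lra.
by rewrite lerXn2r ?nnegrE//; lra.
Qed.

End RealInequalities.

(** * Gain of a correlated pair *)

Section GainRecursion.
Context {R : realType} {K : Type} (y r m : K -> R).
Implicit Type ts : seq K.

(* Per step, [y] is the expected bid, [m] the probability that the step is marked
   (or selects a small bid), weighted by the factor it then contributes to
   prod (1 - a), and [r] the part of that weight lost if the step is the second of a
   pair.  [half_gain] and [pair_gain] are what is lost from [no_gain] when the pair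
   still needs one step, respectively two. *)
Definition no_gain ts : R := \prod_(t <- ts) (1 - y t).

Fixpoint half_gain ts : R :=
  if ts is t :: ts' then
    (1 - y t - m t) * half_gain ts' + r t * no_gain ts'
  else 0.

Fixpoint pair_gain ts : R :=
  if ts is t :: ts' then
    (1 - y t - m t) * pair_gain ts' + r t * half_gain ts'
  else 0.

Lemma no_gain_cons t ts : no_gain (t :: ts) = (1 - y t) * no_gain ts.
Proof. by rewrite /no_gain big_cons. Qed.

Hypothesis r_ge0 : forall t, 0 <= r t.
Hypothesis m_ge0 : forall t, 0 <= m t.
Hypothesis m_le : forall t, m t <= 2 * r t.
Hypothesis ym_le1 : forall t, y t + m t <= 1.
Hypothesis r_le : forall t, 2 * r t <= y t.

Local Notation Rs ts := (\sum_(t <- ts) r t).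
Local Notation r2s ts := (\sum_(t <- ts) r t ^+ 2).

Let sum_r_ge0 ts : 0 <= Rs ts. Proof. by rewrite sumr_ge0. Qed.

Lemma no_gain_ge0 ts : 0 <= no_gain ts.
Proof.
rewrite /no_gain prodr_ge0// => t _.
by have := ym_le1 t; have := m_ge0 t; lra.
Qed.

Lemma half_gain_ge ts : Rs ts <= 1 / 2 ->
  (Rs ts - Rs ts ^+ 2) * no_gain ts <= half_gain ts.
Proof.
elim: ts => [|t ts ih]; first by rewrite big_nil expr0n/= subrr mul0r.
rewrite big_cons no_gain_cons /=.
move: ih (r_ge0 t) (m_le t) (m_ge0 t) (ym_le1 t) (r_le t) (sum_r_ge0 ts) (no_gain_ge0 ts).
move: (r t) (m t) (y t) (Rs ts) (no_gain ts) (half_gain ts) => ρ μ c S D G.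
move=> ih ρ0 μρ μ0 cμ ρc S0 D0 Sle.
have {}ih : (S - S ^+ 2) * D <= G by apply: ih; lra.
have psi0 : 0 <= S - S ^+ 2 by nra.
apply: (@le_trans _ _ ((1 - c - μ) * ((S - S ^+ 2) * D) + ρ * D)); last first.
  by rewrite lerD2r; apply: ler_wpM2l ih; lra.
rewrite -subr_ge0; set e := (X in 0 <= X).
have -> : e = D * ((2 * ρ - μ) * (S - S ^+ 2) + ρ * (c * (1 - 2 * S - ρ))
    + ρ * (2 * S ^+ 2 + ρ)) by rewrite /e; ring.
rewrite mulr_ge0// !addr_ge0// !mulr_ge0//; nra.
Qed.

Lemma half_gain_ge0 ts : Rs ts <= 1 / 2 -> 0 <= half_gain ts.
Proof.
move=> Rle; apply: le_trans (half_gain_ge Rle); rewrite mulr_ge0 ?no_gain_ge0//.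
by have := sum_r_ge0 ts; nra.
Qed.

(* The two factors [r] below are taken at distinct steps, whence the correction
   by the sum of squares. *)
Lemma pair_gain_ge ts : Rs ts <= 1 / 2 ->
  (Rs ts ^+ 2 / 2 - 2 / 3 * Rs ts ^+ 3 - r2s ts / 2) * no_gain ts <= pair_gain ts.
Proof.
move=> Rle; suff [] : 0 <= pair_gain ts /\
    (Rs ts ^+ 2 / 2 - 2 / 3 * Rs ts ^+ 3 - r2s ts / 2) * no_gain ts <= pair_gain ts
  by [].
elim: ts Rle => [|t ts ih].
  by rewrite !big_nil !expr0n/= !(mul0r, mulr0) !subr0 mul0r.
rewrite !big_cons no_gain_cons /=.
have r2 : 0 <= r2s ts by rewrite sumr_ge0// => *; exact: sqr_ge0.
move: ih r2 (@half_gain_ge ts) (@half_gain_ge0 ts).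
move: (r_ge0 t) (m_le t) (m_ge0 t) (ym_le1 t) (r_le t) (sum_r_ge0 ts) (no_gain_ge0 ts).
move: (r t) (m t) (y t) (Rs ts) (r2s ts) (no_gain ts) (half_gain ts) (pair_gain ts) => ρ μ c S Q D G Γ.
move=> ρ0 μρ μ0 cμ ρc S0 D0 ih Q0 hG G0 Sle.
have Sle' : S <= 1 / 2 by lra.
have [{ih} Γ0 hΓ] := ih Sle'; have {}hG := hG Sle'; have {}G0 := G0 Sle'.
split; first by rewrite addr_ge0// mulr_ge0//; lra.
set χ := S ^+ 2 / 2 - 2 / 3 * S ^+ 3 in hΓ.
pose x := Num.max (χ - Q / 2) 0.
have x0 : 0 <= x by rewrite le_max lexx orbT.
have xχ : x <= S ^+ 2 / 2.
  have S3 : 0 <= S ^+ 3 by rewrite exprn_ge0.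
  have S2 := sqr_ge0 S.
  by rewrite /x ge_max /χ; apply/andP; split; lra.
have xΓ : x * D <= Γ by rewrite /x; case: (leP (χ - Q / 2) 0) => _; rewrite ?mul0r.
have χx : χ - Q / 2 <= x by rewrite /x le_max lexx.
apply: (@le_trans _ _ ((1 - c - μ) * (x * D) + ρ * ((S - S ^+ 2) * D))); last first.
  by apply: lerD; apply: ler_wpM2l => //; lra.
apply: (@le_trans _ _ ((x + ρ * (S - S ^+ 2 - 2 * x)) * ((1 - c) * D))).
  apply: ler_wpM2r; first by rewrite mulr_ge0//; lra.
  have h1 : 0 <= ρ * (S ^+ 2 / 2 - x) by rewrite mulr_ge0//; lra.
  have h2 : 0 <= ρ ^+ 2 * S by rewrite mulr_ge0// sqr_ge0.
  have h3 : 0 <= ρ ^+ 3 by rewrite exprn_ge0.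
  rewrite /χ in χx; lra.
rewrite -subr_ge0; set e := (X in 0 <= X).
have -> : e = D * ((2 * ρ - μ) * x + c * ρ * (S - S ^+ 2 - 2 * x)) by rewrite /e; ring.
rewrite mulr_ge0// addr_ge0// !mulr_ge0//; nra.
Qed.

Lemma no_gain_le_expR ts :
  no_gain ts <= expR (- (\sum_(t <- ts) y t + \sum_(t <- ts) y t ^+ 2 / 2)).
Proof.
rewrite -big_split/= -sumrN expR_sum /no_gain.
apply: ler_prod => t _; have := ym_le1 t; have := m_ge0 t; have := r_ge0 t; have := r_le t.
by move=> *; rewrite onem_le_expR ?andbT//; lra.
Qed.

Lemma gain_le ts : Rs ts <= 1 / 2 ->
  no_gain ts - pair_gain ts <=
  expR (- (\sum_(t <- ts) y t)) * (1 - (Rs ts ^+ 2 / 2 - 2 / 3 * Rs ts ^+ 3)).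
Proof.
move=> Rle; have := pair_gain_ge Rle; have := no_gain_le_expR ts.
have Q0 : 0 <= r2s ts by rewrite sumr_ge0// => *; exact: sqr_ge0.
have hQ : 2 * r2s ts <= \sum_(t <- ts) y t ^+ 2 / 2.
  rewrite mulr_sumr; apply: ler_sum => t _; have := r_ge0 t; have := r_le t.
  by move=> h1 h2; nra.
have D0 := no_gain_ge0 ts; have S0 := sum_r_ge0 ts.
rewrite opprD expRD.
set χ := Rs ts ^+ 2 / 2 - 2 / 3 * Rs ts ^+ 3.
have χ0 : 0 <= χ by rewrite /χ; have := sqr_ge0 (Rs ts); nra.
have χ1 : χ <= 1 / 2.
  have S3 : 0 <= Rs ts ^+ 3 by rewrite exprn_ge0.
  have S2 : Rs ts ^+ 2 <= 1 / 2 by nra.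
  rewrite /χ; lra.
move: (r2s ts) Q0 hQ => Q Q0 hQ; set w := expR (- _); set v := expR (- _) => hD hP.
have hv : v * (1 + 2 * Q) <= 1.
  rewrite /v expRN mulrC ler_pdivrMr ?expR_gt0// mul1r.
  by apply: le_trans (expR_ge1Dx _); lra.
have w0 : 0 <= w by exact: expR_ge0.
apply: (@le_trans _ _ (no_gain ts * (1 - χ + Q / 2))); first by lra.
apply: (@le_trans _ _ (w * v * (1 - χ + Q / 2))).
  by apply: ler_wpM2r hD; lra.
rewrite -mulrA; apply: ler_wpM2l => //.
apply: (@le_trans _ _ (v * (1 + 2 * Q) * (1 - χ))); last first.
  by rewrite -[leRHS]mul1r; apply: ler_wpM2r hv; lra.
rewrite -mulrA; apply: ler_wpM2l; first exact: expR_ge0.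
nra.
Qed.

End GainRecursion.

(** * Iterated expectations *)

Section IteratedExpectation.
Context {R : realType} {K : Type} {O : finType} {St : Type}.
Variables (p : K -> O -> R) (step : K -> St -> O -> St) (F : St -> R).

Fixpoint iter_exp (ts : seq K) (st : St) : R :=
  if ts is t :: ts' then \sum_o p t o * iter_exp ts' (step t st o) else F st.

Lemma sum_ffun_recl n (h : {ffun 'I_n.+1 -> O} -> R) :
  \sum_x h x =
  \sum_o \sum_(x : {ffun 'I_n -> O})
    h [ffun k => if unlift ord0 k is Some k' then x k' else o].
Proof.
rewrite pair_bigA /=.
rewrite (reindex (fun ox : O * {ffun 'I_n -> O} =>
  [ffun k => if unlift ord0 k is Some k' then ox.2 k' else ox.1]))//=.
exists (fun x : {ffun 'I_n.+1 -> O} => (x ord0, [ffun k => x (lift ord0 k)])) => [[q x] _|x _] /=.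
  rewrite ffunE unlift_none; congr (_, _).
  by apply/ffunP => k; rewrite !ffunE liftK.
apply/ffunP => k; rewrite ffunE.
by case: unliftP => [k' ->|->] //=; rewrite ffunE.
Qed.

Lemma sum_ffun_iter_exp n (e : 'I_n -> K) st :
  \sum_(x : {ffun 'I_n -> O}) (\prod_k p (e k) (x k)) *
    F (foldl (fun st k => step (e k) st (x k)) st (enum 'I_n)) =
  iter_exp [seq e k | k <- enum 'I_n] st.
Proof.
elim: n e st => [|n ih] e st.
  have enum0 : enum 'I_0 = [::] by apply: size0nil; rewrite size_enum_ord.
  rewrite enum0 /= (eq_bigr (fun=> F st)) => [|x _]; last by rewrite big_ord0 mul1r.
  by rewrite sumr_const card_ffun card_ord expn0.
rewrite sum_ffun_recl enum_ordSl /=; apply: eq_bigr => o _.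
rewrite -map_comp -(ih (e \o lift ord0)) mulr_sumr; apply: eq_bigr => x _.
rewrite big_ord_recl !ffunE unlift_none -mulrA; congr (_ * (_ * F _)).
  by apply: eq_bigr => k _; rewrite ffunE liftK.
elim: (enum _) (step _ _ _) => //= k s ihs u.
by rewrite ihs ffunE liftK.
Qed.

End IteratedExpectation.

Section ShortfallLowerBound.
Context {R : realType} {K : Type} {O : finType}.
Variables (p : K -> O -> R) (hit : K -> O -> bool) (w : K -> O -> R).
Hypothesis p_ge0 : forall t q, 0 <= p t q.
Hypothesis p_sum1 : forall t, \sum_q p t q = 1.
Hypothesis w_hit : forall t q, ~~ hit t q -> w t q = 0.
Hypothesis w01 : forall t q, 0 <= w t q <= 1.

Let hit_rate t := \sum_(q | hit t q) p t q.
Let w_mean t := \sum_q p t q * w t q.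

Let w_mean_hit t : w_mean t = \sum_(q | hit t q) p t q * w t q.
Proof.
rewrite /w_mean (bigID (hit t))/= [X in _ + X]big1 ?addr0// => q qt.
by rewrite w_hit// mulr0.
Qed.

Definition shortfall := iter_exp p (fun t A q => A + w t q) (fun A => pos_part (1 - A)).

Let miss_rate t : \sum_(q | ~~ hit t q) p t q = 1 - hit_rate t.
Proof. by apply/eqP; rewrite eq_sym subr_eq addrC -[X in X == _](p_sum1 t) (bigID (hit t)). Qed.

Lemma shortfall_cons t ts A : shortfall (t :: ts) A =
  \sum_(q | hit t q) p t q * shortfall ts (A + w t q) +
  (1 - hit_rate t) * shortfall ts A.
Proof.
rewrite /shortfall /= (bigID (hit t))/=; congr (_ + _).
rewrite -miss_rate mulr_suml; apply: eq_bigr => q qt.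
by rewrite w_hit// addr0.
Qed.

Lemma hit_rate01 t : 0 <= hit_rate t <= 1.
Proof.
rewrite sumr_ge0//= -subr_ge0 -miss_rate sumr_ge0//.
Qed.

Lemma prod_miss01 ts : 0 <= \prod_(t <- ts) (1 - hit_rate t) <= 1.
Proof.
elim: ts => [|t ts /andP[h0 h1]]; first by rewrite big_nil ler01 lexx.
rewrite big_cons; have /andP[f0 f1] := hit_rate01 t.
by rewrite mulr_ge0 ?subr_ge0//= mulr_ile1 ?subr_ge0//; lra.
Qed.

Lemma shortfall_ge0 ts A : 0 <= shortfall ts A.
Proof.
rewrite /shortfall; elim: ts A => [|t ts ih] A /=.
  by rewrite /pos_part le_max lexx orbT.
by apply: sumr_ge0 => q _; rewrite mulr_ge0.
Qed.

Lemma shortfall_ge_no_hit ts A : A <= 1 ->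
  (1 - A) * \prod_(t <- ts) (1 - hit_rate t) <= shortfall ts A.
Proof.
elim: ts A => [|t ts ih] A A1.
  by rewrite big_nil mulr1 /shortfall/= /pos_part le_max lexx.
rewrite shortfall_cons big_cons mulrCA -[leLHS]add0r lerD//.
  by apply: sumr_ge0 => q _; rewrite mulr_ge0 ?shortfall_ge0.
by rewrite ler_wpM2l ?ih// subr_ge0; case/andP: (hit_rate01 t).
Qed.

Lemma shortfall_ge ts :
  \prod_(t <- ts) (1 - hit_rate t) *
    (1 + \sum_(t <- ts) hit_rate t - \sum_(t <- ts) w_mean t) <= shortfall ts 0.
Proof.
elim: ts => [|t ts ih].
  by rewrite !big_nil mul1r /shortfall/= /pos_part le_max !subr0 addr0 lexx.
rewrite shortfall_cons !big_cons.
have /andP[P0 P1] := prod_miss01 ts; have /andP[f0 f1] := hit_rate01 t.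
set P := \prod_(t <- ts) _ in ih P0 P1 *.
have hits : (hit_rate t - w_mean t) * P <= \sum_(q | hit t q) p t q * shortfall ts (0 + w t q).
  have -> : hit_rate t - w_mean t = \sum_(q | hit t q) p t q * (1 - w t q).
    by rewrite w_mean_hit -sumrB; apply: eq_bigr => q _; rewrite mulrBr mulr1.
  rewrite mulr_suml; apply: ler_sum => q _; rewrite -mulrA add0r ler_wpM2l//.
  by apply: shortfall_ge_no_hit; case/andP: (w01 t q).
have d0 : 0 <= hit_rate t - w_mean t.
  rewrite subr_ge0 w_mean_hit.
  by apply: ler_sum => q _; rewrite ler_piMr//; case/andP: (w01 t q).
apply: le_trans (lerD hits (ler_wpM2l _ ih)); last by rewrite subr_ge0.
have : (1 - hit_rate t) * P * (hit_rate t - w_mean t) <= P * (hit_rate t - w_mean t).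
  by rewrite ler_wpM2r// ler_piMl//; lra.
lra.
Qed.

End ShortfallLowerBound.

(** * The process seen by one agent *)

Lemma sum_pair (V : nmodType) (A B : finType) (f : A * B -> V) :
  \sum_q f q = \sum_a \sum_b f (a, b).
Proof. by rewrite pair_bigA; apply: eq_bigr => -[]. Qed.

Lemma pos_part_ge0 (R : realType) (z : R) : 0 <= pos_part z.
Proof. by rewrite /pos_part le_max lexx orbT. Qed.

Lemma pos_part_ge (R : realType) (z : R) : z <= pos_part z.
Proof. by rewrite /pos_part le_max lexx. Qed.

Lemma pos_part_le (R : realType) (z w : R) : 0 <= w -> z <= w -> pos_part z <= w.
Proof. by move=> w0 zw; rewrite /pos_part ge_max zw. Qed.

Lemma pos_part_eq0 (R : realType) (z : R) : z <= 0 -> pos_part z = 0.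
Proof. by move=> z0; rewrite /pos_part; apply/max_idPr. Qed.

(* [None]: never marked; [Some (Some b)]: marked once, and [b] tells whether the
   marking agent was selected; [Some None]: marked at least twice. *)
Notation mark_state := (option (option bool)).

Definition next_mark (s : mark_state) (b : bool) : mark_state :=
  if s is None then Some (Some b) else Some None.

Section AgentProcess.
Context {R : realType} {I J : finType} {K : Type}.
Variables (beta : I -> R) (marks : I -> agent J -> bool) (j : J).
Hypothesis beta_ge0 : forall i, 0 <= beta i.
Hypothesis beta_le1 : forall i, beta i <= 1.
Hypothesis marks_agent : forall i, marks i (Some j) = (2 / 3 <= beta i).

Local Notation outcome := (option (I * (agent J * agent J))).
Variable pi : K -> outcome -> R.
Hypothesis pi_ge0 : forall t q, 0 <= pi t q.
Hypothesis pi_sum1 : forall t, \sum_q pi t q = 1.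

Local Notation marks_of := {ffun agent J -> mark_state}.

Definition set_mark (s : marks_of) (k : agent J) (v : mark_state) : marks_of :=
  [ffun k' => if k' == k then v else s k'].

Definition gain (i : I) (k : agent J) : R := if k == Some j then beta i else 0.

Definition agent_step (q : outcome) (mcoin scoin : bool) (st : R * marks_of) :
    R * marks_of :=
  if q is Some (i, (a, a')) then
    if a == a' then (st.1 + gain i a, st.2) else
    let m := if mcoin then a else a' in
    let m' := if mcoin then a' else a in
    let u := if scoin then a else a' in
    if marks i m then
      let s := if st.2 m is Some (Some b) then if b then m' else m else u in
      (st.1 + gain i s, set_mark st.2 m (next_mark (st.2 m) (s == m)))
    else (st.1 + gain i u, st.2)
  else st.

Definition outcome_law (t : K) (o : outcome * (bool * bool)) : R :=
  pi t o.1 / 4.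

Definition value (ts : seq K) (A : R) (s : marks_of) : R :=
  iter_exp outcome_law
    (fun _ st o => agent_step o.1 o.2.1 o.2.2 st)
    (fun st => pos_part (1 - st.1)) ts (A, s).

Definition coin_avg (f : bool -> bool -> R) : R :=
  (f true true + f true false + (f false true + f false false)) / 4.

Lemma value_cons t ts A s :
  value (t :: ts) A s =
  \sum_q pi t q * coin_avg (fun mc sc =>
    let st := agent_step q mc sc (A, s) in value ts st.1 st.2).
Proof.
rewrite {1}/value /=.
rewrite sum_pair; apply: eq_bigr => q _.
rewrite sum_pair !big_bool /outcome_law /coin_avg /value /=.
do !case: (agent_step _ _ _ _) => ? ? /=.
by field.
Qed.

Lemma agent_step_shift q mc sc A s :
  agent_step q mc sc (A, s) =
  (A + (agent_step q mc sc (0, s)).1, (agent_step q mc sc (0, s)).2).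
Proof.
rewrite /agent_step; case: q => [[i [a a']]|] /=; last by rewrite addr0.
by case: ifP => _ /=; [|case: ifP => _ /=]; rewrite add0r.
Qed.

Lemma agent_step_gain_ge0 q mc sc s : 0 <= (agent_step q mc sc (0, s)).1.
Proof.
have g0 i k : 0 <= gain i k by rewrite /gain; case: ifP.
rewrite /agent_step; case: q => [[i [a a']]|] //=.
by case: ifP => _ /=; [|case: ifP => _ /=]; rewrite add0r.
Qed.

Lemma value_ge0 ts A s : 0 <= value ts A s.
Proof.
elim: ts A s => [|t ts ih] A s; first exact: pos_part_ge0.
rewrite value_cons sumr_ge0// => q _; rewrite mulr_ge0// /coin_avg.
by rewrite divr_ge0 ?addr_ge0.
Qed.

Lemma ler_coin_avg f f' : (forall mc, f mc true + f mc false <= f' mc true + f' mc false) ->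
  coin_avg f <= coin_avg f'.
Proof.
by move=> ff'; rewrite /coin_avg; have := (ff' true, ff' false) => -[] ? ?; lra.
Qed.

Lemma value_full ts A s : 1 <= A -> value ts A s = 0.
Proof.
elim: ts A s => [|t ts ih] A s A1; first by rewrite /value/= pos_part_eq0// subr_le0.
rewrite value_cons big1// => q _.
have v0 mc sc : value ts (agent_step q mc sc (A, s)).1 (agent_step q mc sc (A, s)).2 = 0.
  by rewrite agent_step_shift /= ih// (le_trans A1)// lerDl agent_step_gain_ge0.
by rewrite /coin_avg !v0 !addr0 mul0r mulr0.
Qed.

Lemma value_convex ts c A B s : 0 <= c <= 1 ->
  value ts (c * A + (1 - c) * B) s <= c * value ts A s + (1 - c) * value ts B s.
Proof.
move=> /andP[c0 c1].
elim: ts A B s => [|t ts ih] A B s.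
  rewrite /value/=; apply: pos_part_le.
    by rewrite addr_ge0// mulr_ge0 ?pos_part_ge0// subr_ge0.
  have h1 : c * (1 - A) <= c * pos_part (1 - A) by rewrite ler_wpM2l// pos_part_ge.
  have h2 : (1 - c) * (1 - B) <= (1 - c) * pos_part (1 - B).
    by rewrite ler_wpM2l ?pos_part_ge// subr_ge0.
  lra.
rewrite !value_cons !mulr_sumr -big_split/=; apply: ler_sum => q _.
set X := coin_avg _; set Y := coin_avg _; set Z := coin_avg _.
suff /(ler_wpM2l (pi_ge0 t q)) : X <= c * Y + (1 - c) * Z by lra.
have h mc sc : value ts (agent_step q mc sc (c * A + (1 - c) * B, s)).1
      (agent_step q mc sc (c * A + (1 - c) * B, s)).2 <=
    c * value ts (agent_step q mc sc (A, s)).1 (agent_step q mc sc (A, s)).2 +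
    (1 - c) * value ts (agent_step q mc sc (B, s)).1 (agent_step q mc sc (B, s)).2.
  rewrite agent_step_shift (agent_step_shift _ _ _ A) (agent_step_shift _ _ _ B) /=.
  set d := (_ (0, s)).1; set s' := (_ (0, s)).2.
  by have -> : c * A + (1 - c) * B + d = c * (A + d) + (1 - c) * (B + d) by ring.
rewrite /X /Y /Z /coin_avg.
have := (h true true, h true false, h false true, h false false).
by move=> [[[]]]; lra.
Qed.

Lemma value_supermodular ts A a b s : 0 <= a -> 0 <= b ->
  value ts (A + a) s + value ts (A + b) s <=
  value ts A s + value ts (A + a + b) s.
Proof.
move=> a0 b0; have [ab0|ab0] := eqVneq (a + b) 0.
  have -> : a = 0 by lra.
  have -> : b = 0 by lra.
  by rewrite !addr0.
have ab : 0 < a + b by rewrite lt_neqAle eq_sym ab0 addr_ge0.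
have c01 : 0 <= b / (a + b) <= 1.
  by rewrite divr_ge0 ?addr_ge0//= ler_pdivrMr// mul1r; lra.
have c01' : 0 <= a / (a + b) <= 1.
  by rewrite divr_ge0 ?addr_ge0//= ler_pdivrMr// mul1r; lra.
have := lerD (value_convex ts A (A + a + b) s c01) (value_convex ts A (A + a + b) s c01').
have -> : b / (a + b) * A + (1 - b / (a + b)) * (A + a + b) = A + a by field.
have -> : a / (a + b) * A + (1 - a / (a + b)) * (A + a + b) = A + b by field.
have -> : a / (a + b) = 1 - b / (a + b) by field.
lra.
Qed.

Lemma set_markE s k v : set_mark s k v k = v.
Proof. by rewrite ffunE eqxx. Qed.

Lemma set_mark_neq s k v k' : k' != k -> set_mark s k v k' = s k'.
Proof. by rewrite ffunE => /negbTE ->. Qed.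

Lemma set_mark2 s k v v' : set_mark (set_mark s k v) k v' = set_mark s k v'.
Proof. by apply/ffunP => k'; rewrite !ffunE; case: eqP. Qed.

Lemma set_markC s k v k' v' : k != k' ->
  set_mark (set_mark s k v) k' v' = set_mark (set_mark s k' v') k v.
Proof.
by move=> kk'; apply/ffunP => l; rewrite !ffunE; case: eqP => // ->;
   rewrite eq_sym (negbTE kk').
Qed.

(* After one step marked with [k], the bit says whether agent [j] was selected
   there if [k = j], and whether [k] was selected otherwise; in both cases the
   next step marked with [k] is the less favourable for [j] the more favourable
   this one was. *)
Lemma value_pending_le ts k A a s : 0 <= a ->
  value ts (A + a) (set_mark s k (Some (Some (k == Some j)))) +
  value ts A (set_mark s k (Some (Some (k != Some j)))) <=
  value ts (A + a) (set_mark s k (Some None)) +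
  value ts A (set_mark s k (Some None)).
Proof.
move=> a0; elim: ts A s => [|t ts ih] A s; first by rewrite /value.
rewrite !value_cons -!big_split/=; apply: ler_sum => q _.
rewrite -!mulrDr ler_wpM2l//.
pose val v A mc sc := let st := agent_step q mc sc (A, set_mark s k v) in value ts st.1 st.2.
suff h mc :
    val (Some (Some (k == Some j))) (A + a) mc true +
    val (Some (Some (k != Some j))) A mc true +
    (val (Some (Some (k == Some j))) (A + a) mc false +
    val (Some (Some (k != Some j))) A mc false) <=
    val (Some None) (A + a) mc true + val (Some None) A mc true +
    (val (Some None) (A + a) mc false + val (Some None) A mc false).
  by have := (h true, h false); rewrite /val /coin_avg => -[]; lra.
rewrite {}/val /agent_step; case: q => [[i [b b']]|] /=; last by apply: lerD.
case: ifP => [_|/negbT bb'] /=.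
  by rewrite (addrAC A a); apply: lerD.
case: ifP => mm /=; last by rewrite !(addrAC A a); apply: lerD.
set m := if mc then b else b' in mm *; set m' := if mc then b' else b.
have mm' : m' != m by rewrite /m /m'; case: (mc) => //; rewrite eq_sym.
have [km|km] := eqVneq k m; last first.
  have mk : m != k by rewrite eq_sym.
  rewrite !set_mark_neq// !(set_markC _ _ _ km) !(addrAC A a).
  by apply: lerD.
rewrite -km !set_markE !set_mark2 /=.
have g0 i' l : 0 <= gain i' l by rewrite /gain; case: ifP.
have first0 : gain i (if k == Some j then m' else m) = 0.
  rewrite /gain; have [kj|kj] := eqVneq k (Some j).
    by rewrite -kj km (negbTE mm').
  by rewrite -km (negbTE kj).
have -> : (if k == Some j then m' else k) = (if k == Some j then m' else m).
  by rewrite km.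
have -> : (if k != Some j then m' else k) = (if k == Some j then m else m').
  by rewrite km; case: (_ == Some j).
rewrite first0 addr0.
set g := gain i (if k == Some j then m else m').
have coins : (gain i b = 0 /\ gain i b' = g) \/ (gain i b = g /\ gain i b' = 0).
  rewrite /g; move: first0; rewrite /m /m'.
  by case: (k == _); case: (mc); [right|left|left|right].
have := @value_supermodular ts A a g (set_mark s k (Some None)) a0 (g0 _ _).
by case: coins => -[-> ->]; rewrite !addr0; lra.
Qed.

Lemma value_unmarked_le ts k A s :
  value ts A (set_mark s k None) <= value ts A (set_mark s k (Some None)).
Proof.
elim: ts A s => [|t ts ih] A s; first by rewrite /value.
rewrite !value_cons; apply: ler_sum => q _; rewrite ler_wpM2l//.
apply: ler_coin_avg => mc.
rewrite /agent_step; case: q => [[i [b b']]|] /=; last by apply: lerD.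
case: ifP => [_|/negbT bb'] /=; first by apply: lerD.
case: ifP => mm /=; last by apply: lerD.
set m := if mc then b else b' in mm *; set m' := if mc then b' else b.
have mm' : m' != m by rewrite /m /m'; case: (mc) => //; rewrite eq_sym.
have [km|km] := eqVneq k m; last first.
  have mk : m != k by rewrite eq_sym.
  rewrite !set_mark_neq// !(set_markC _ _ _ km).
  by apply: lerD; case: (s m) => [[?|]|].
rewrite -km !set_markE !set_mark2 /=.
have g0 i' l : 0 <= gain i' l by rewrite /gain; case: ifP.
have first0 : gain i (if k == Some j then m' else m) = 0.
  rewrite /gain; have [kj|kj] := eqVneq k (Some j).
    by rewrite -kj km (negbTE mm').
  by rewrite -km (negbTE kj).
set g := gain i (if k == Some j then m else m').
have := @value_pending_le ts k A g s (g0 _ _).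
suff [[-> -> -> ->]|[-> -> -> ->]] :
    [/\ gain i b = 0, gain i b' = g, (b == k) = (k != Some j) & (b' == k) = (k == Some j)] \/
    [/\ gain i b = g, gain i b' = 0, (b == k) = (k == Some j) & (b' == k) = (k != Some j)].
- by rewrite addr0; lra.
- by rewrite addr0; lra.
rewrite /g; move: first0 mm'; rewrite km /m /m'; case: (_ == Some j); case: (mc) => f0 nbb'.
- by right; split=> //; rewrite ?eqxx// (negbTE nbb').
- by left; split=> //; rewrite ?eqxx// (negbTE nbb').
- by left; split=> //; rewrite ?eqxx// (negbTE nbb').
- by right; split=> //; rewrite ?eqxx// (negbTE nbb').
Qed.

Lemma value_saturate ts A (B : {pred agent J}) :
  value ts A [ffun=> None] <= value ts A [ffun k => if k \in B then Some None else None].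
Proof.
rewrite -(eq_ffun _ (fun k => congr1 (fun b : bool => if b then _ else _) (mem_enum B k))).
elim: (enum B) => [|k l ih]; first by rewrite le_eqVlt; apply/orP; left; apply/eqP; congr value.
apply: (le_trans ih) => {ih}; set s := (X in value _ _ X <= _).
have [kl|kl] := boolP (k \in l).
  rewrite le_eqVlt; apply/orP; left; apply/eqP; congr value.
  by apply/ffunP => k'; rewrite !ffunE inE; case: eqP => // ->; rewrite kl.
have {1}-> : s = set_mark s k None.
  by apply/ffunP => k'; rewrite !ffunE; case: eqP => // ->; rewrite (negbTE kl).
apply: le_trans (value_unmarked_le _ _ _ _) _.
rewrite le_eqVlt; apply/orP; left; apply/eqP; congr value.
by apply/ffunP => k'; rewrite !ffunE inE; case: eqP.
Qed.

(* Once every other agent has two marked steps behind it, the only correlation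
   left is the one due to the marks of [j]. *)
Definition others_spent (v : mark_state) : marks_of :=
  [ffun k => if k == Some j then v else Some None].

Definition spent_value ts A v := value ts A (others_spent v).

Lemma spent_value_ge0 ts A v : 0 <= spent_value ts A v.
Proof. exact: value_ge0. Qed.

Lemma set_mark_others_spent v v' :
  set_mark (others_spent v) (Some j) v' = others_spent v'.
Proof. by apply/ffunP => k; rewrite !ffunE; case: eqP. Qed.

Lemma set_mark_spent v k : k != Some j ->
  set_mark (others_spent v) k (Some None) = others_spent v.
Proof.
move=> kj; apply/ffunP => k'; rewrite !ffunE.
by case: eqP => // ->; rewrite (negbTE kj).
Qed.

(* The number of [eta] and [eta + 1/2] that fall into the interval of [j]. *)
Definition halves (q : outcome) : R :=
  if q is Some (i, (a, a')) then (a == Some j)%:R + (a' == Some j)%:R else 0.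

Definition bid_frac (q : outcome) : R := if q is Some (i, _) then beta i else 0.

Definition markable (q : outcome) : bool :=
  if q is Some (i, (a, a')) then
    ((a == Some j) (+) (a' == Some j)) && (2 / 3 <= beta i)
  else false.

Definition expected_frac (q : outcome) : R := halves q / 2 * bid_frac q.

Definition marked_value ts A b v : R :=
  match v with
  | None => (spent_value ts (A + b) (Some (Some true)) +
             spent_value ts A (Some (Some false))) / 2
  | Some (Some true) => spent_value ts A (Some None)
  | Some (Some false) => spent_value ts (A + b) (Some None)
  | Some None => (spent_value ts (A + b) (Some None) +
                  spent_value ts A (Some None)) / 2
  end.

Lemma spent_value_cons t ts A v :
  spent_value (t :: ts) A v =
  \sum_q pi t q *
    (if markable q then
       (spent_value ts (A + bid_frac q) v + spent_value ts A v) / 4 +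
       marked_value ts A (bid_frac q) v / 2
     else halves q / 2 * spent_value ts (A + bid_frac q) v +
          (1 - halves q / 2) * spent_value ts A v).
Proof.
rewrite /spent_value value_cons; apply: eq_bigr => q _; congr (_ * _).
rewrite /coin_avg /agent_step; case: q => [[i [a a']]|] /=; last first.
  by rewrite mul0r subr0 mul1r; field.
have spentk k : k != Some j -> others_spent v k = Some None.
  by rewrite ffunE => /negbTE ->.
have vj : others_spent v (Some j) = v by rewrite ffunE eqxx.
have [<-|aa'] := eqVneq a a' => /=.
  by rewrite addbb /= /gain; case: eqP => _ /=; rewrite ?addr0 /value; field.
have [aj|aj] := eqVneq a (Some j); have [a'j|a'j] := eqVneq a' (Some j) => /=.
- by move: aa'; rewrite aj a'j eqxx.
- rewrite aj marks_agent vj spentk// /next_mark /= set_mark_spent// !set_mark_others_spent.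
  have gj : gain i (Some j) = beta i by rewrite /gain eqxx.
  have gm : gain i a' = 0 by rewrite /gain (negbTE a'j).
  case: (2 / 3 <= _) => /=; last by case: (marks _ _); rewrite /= gj gm addr0; field.
  case: v {vj spentk} => [[[]|]|] /=; rewrite ?eqxx ?(negbTE a'j) /marked_value /spent_value /=;
    by case: (marks _ _); rewrite /= ?gj ?gm ?addr0; field.
- rewrite a'j marks_agent vj spentk// /next_mark /= set_mark_spent// !set_mark_others_spent.
  have gj : gain i (Some j) = beta i by rewrite /gain eqxx.
  have gm : gain i a = 0 by rewrite /gain (negbTE aj).
  case: (2 / 3 <= _) => /=; last by case: (marks _ _); rewrite /= gj gm addr0; field.
  case: v {vj spentk} => [[[]|]|] /=; rewrite ?eqxx ?(negbTE aj) /marked_value /spent_value /=;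
    by case: (marks _ _); rewrite /= ?gj ?gm ?addr0; field.
rewrite !spentk// /next_mark !set_mark_spent// /gain (negbTE aj) (negbTE a'j) /= !addr0.
by case: ifP => _; case: ifP => _ /=; field.
Qed.

Lemma halves_ge0 q : 0 <= halves q / 2 <= 1.
Proof.
case: q => [[i [a a']]|] /=; last by rewrite mul0r lexx ler01.
by case: (_ == _); case: (_ == _) => /=; lra.
Qed.

Lemma bid_frac01 q : 0 <= bid_frac q <= 1.
Proof. by case: q => [[i ?]|] /=; rewrite ?lexx ?ler01// beta_ge0 beta_le1. Qed.

Lemma markable_halves q : markable q -> halves q = 1 /\ 2 / 3 <= bid_frac q.
Proof.
case: q => [[i [a a']]|] //= /andP[+ ?].
by case: (_ == _); case: (_ == _) => //= _; rewrite ?addr0 ?add0r.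
Qed.

Lemma pos_part_onemD (A b : R) : 0 <= A -> 0 <= b <= 1 ->
  pos_part (1 - (A + b)) <= pos_part (1 - A) * (1 - b).
Proof.
move=> A0 /andP[b0 b1]; apply: pos_part_le.
  by rewrite mulr_ge0 ?pos_part_ge0// subr_ge0.
have : (1 - A) * (1 - b) <= pos_part (1 - A) * (1 - b).
  by rewrite ler_wpM2r ?pos_part_ge// subr_ge0.
have : 0 <= A * b by rewrite mulr_ge0.
lra.
Qed.

Definition load_at t := \sum_q pi t q * expected_frac q.

Lemma sum_pi_affine t (f f1 f2 f3 : outcome -> R) x c0 c1 c2 c3 :
  (forall q, f q <= x * (c0 + c1 * f1 q + c2 * f2 q + c3 * f3 q)) ->
  \sum_q pi t q * f q <= x * (c0 + c1 * (\sum_q pi t q * f1 q) +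
    c2 * (\sum_q pi t q * f2 q) + c3 * (\sum_q pi t q * f3 q)).
Proof.
move=> fle; have {1}-> : c0 = c0 * \sum_q pi t q by rewrite pi_sum1 mulr1.
rewrite !mulr_sumr -!big_split/= mulr_sumr; apply: ler_sum => q _.
by have := ler_wpM2l (pi_ge0 t q) (fle q); lra.
Qed.

(* Probability weights of a step marked with [j], for use as [r] and [m] in
   [pair_gain]. *)
Definition mark_r q := if markable q then bid_frac q / 4 else 0.
Definition mark_m q := if markable q then (1 - bid_frac q / 2) / 2 else 0.

Local Notation r t := (\sum_q pi t q * mark_r q).
Local Notation m t := (\sum_q pi t q * mark_m q).

Lemma spent_value_le_mark ts A : 0 <= A ->
  let D := no_gain load_at ts in
  let G := half_gain load_at (fun t => r t) (fun t => m t) ts in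
  let P := pair_gain load_at (fun t => r t) (fun t => m t) ts in
  [/\ spent_value ts A (Some None) <= pos_part (1 - A) * D,
      spent_value ts A (Some (Some true)) <= pos_part (1 - A) * (D + G),
      spent_value ts A (Some (Some false)) <= pos_part (1 - A) * (D - G)
    & spent_value ts A None <= pos_part (1 - A) * (D - P)].
Proof.
elim: ts A => [|t ts ih] A A0 D G P.
  by rewrite /D /G /P /no_gain big_nil /= addr0 subr0 mulr1.
pose D' := no_gain load_at ts.
pose G' := half_gain load_at (fun t => r t) (fun t => m t) ts.
pose P' := pair_gain load_at (fun t => r t) (fun t => m t) ts.
rewrite -/D' -/G' -/P' in ih.
have c_ge0 v c : (forall B, 0 <= B -> spent_value ts B v <= pos_part (1 - B) * c) -> 0 <= c.
  move=> /(_ 0 (lexx _)) /(le_trans (spent_value_ge0 _ _ _)).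
  by rewrite subr0 /pos_part maxEle ler10 mul1r.
have h2 B (B0 : 0 <= B) : spent_value ts B (Some None) <= pos_part (1 - B) * D' by case: (ih B B0).
have ht B (B0 : 0 <= B) :
    spent_value ts B (Some (Some true)) <= pos_part (1 - B) * (D' + G') by case: (ih B B0).
have hf B (B0 : 0 <= B) :
    spent_value ts B (Some (Some false)) <= pos_part (1 - B) * (D' - G')
  by case: (ih B B0).
have h0 B (B0 : 0 <= B) : spent_value ts B None <= pos_part (1 - B) * (D' - P') by case: (ih B B0).
have D0 := c_ge0 _ _ h2; have Gt0 := c_ge0 _ _ ht; have Gf0 := c_ge0 _ _ hf.
have P0 := c_ge0 _ _ h0.
have xb q := pos_part_onemD A0 (bid_frac01 q).
have shift v c q : 0 <= c ->
    (forall B, 0 <= B -> spent_value ts B v <= pos_part (1 - B) * c) ->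
    spent_value ts (A + bid_frac q) v <= pos_part (1 - A) * (1 - bid_frac q) * c.
  move=> c0 hv; have /andP[b0 _] := bid_frac01 q.
  apply: le_trans (hv _ _) _; first by rewrite addr_ge0.
  by rewrite ler_wpM2r.
have step v c w1 w2 w3 (hv : forall B, 0 <= B -> spent_value ts B v <= pos_part (1 - B) * c) :
    (forall q, markable q -> marked_value ts A (bid_frac q) v <=
      pos_part (1 - A) * (c * (1 - bid_frac q / 2) + w2 * (bid_frac q / 2) +
        w3 * (1 - bid_frac q / 2))) ->
    w1 = - c ->
    spent_value (t :: ts) A v <= pos_part (1 - A) * (c + w1 * load_at t + w2 * r t + w3 * m t).
  move=> hm ->; have c0 := c_ge0 _ _ hv; rewrite spent_value_cons; apply: sum_pi_affine => q.
  have hv0 := hv _ A0; have hv1 := shift _ _ q c0 hv.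
  rewrite /expected_frac /mark_r /mark_m; case: ifPn => mq.
    have [-> _] := markable_halves mq; have := hm _ mq.
    lra.
  have /andP[l0 l1] := halves_ge0 q.
  have := ler_wpM2l l0 hv1.
  have := @ler_wpM2l _ (1 - halves q / 2) _ _ _ hv0.
  rewrite subr_ge0 => /(_ l1).
  lra.
rewrite /D /G /P no_gain_cons /= -/D' -/G' -/P'.
split.
- rewrite [X in _ * X](_ : _ =
      D' + (- D') * load_at t + 0 * r t + 0 * m t); last by ring.
  apply: step => // q mq /=.
  by have := h2 _ A0; have := shift _ _ q D0 h2; lra.
- rewrite [X in _ * X](_ : _ =
      D' + G' + (- (D' + G')) * load_at t + D' * r t + (- G') * m t); last by ring.
  apply: step => // q mq /=.
  by have := h2 _ A0; lra.
- rewrite [X in _ * X](_ : _ =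
      D' - G' + (- (D' - G')) * load_at t + (- D') * r t + G' * m t); last by ring.
  apply: step => // q mq /=.
  by have := shift _ _ q D0 h2; lra.
- rewrite [X in _ * X](_ : _ =
      D' - P' + (- (D' - P')) * load_at t + (- G') * r t + P' * m t); last by ring.
  apply: step => // q mq /=.
  by have := hf _ A0; have := shift _ _ q Gt0 ht; lra.
Qed.

Definition small_r q := if bid_frac q < 2 / 3 then expected_frac q / 2 else 0.

Local Notation rs t := (\sum_q pi t q * small_r q).

Lemma spent_value_small ts A b v : 0 <= b <= 2 / 3 ->
  spent_value ts (A + b) v <= (1 - 3 / 2 * b) * spent_value ts A v +
    3 / 2 * b * spent_value ts (A + 2 / 3) v.
Proof.
move=> /andP[b0 b1].
have := @value_convex ts (3 / 2 * b) (A + 2 / 3) A (others_spent v).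
have -> : 3 / 2 * b * (A + 2 / 3) + (1 - 3 / 2 * b) * A = A + b by field.
by move=> h; rewrite [leRHS]addrC; apply: h; lra.
Qed.

(* By convexity a bid below [2/3] may be replaced by one of exactly [2/3] with
   the same mean; two selected bids of [2/3] already exhaust the budget. *)
Lemma spent_value_le_small ts A : 0 <= A ->
  let D := no_gain load_at ts in
  let G := half_gain load_at (fun t => rs t) (fun t => rs t) ts in
  let P := pair_gain load_at (fun t => rs t) (fun t => rs t) ts in
  (2 / 3 <= A -> spent_value ts A (Some None) <= pos_part (1 - A) * (D - G)) /\
  spent_value ts A (Some None) <= pos_part (1 - A) * (D - P).
Proof.
elim: ts A => [|t ts ih] A A0 D G P.
  by rewrite /D /G /P /no_gain big_nil /= subr0 mulr1.
pose D' := no_gain load_at ts.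
pose G' := half_gain load_at (fun t => rs t) (fun t => rs t) ts.
pose P' := pair_gain load_at (fun t => rs t) (fun t => rs t) ts.
rewrite -/D' -/G' -/P' in ih.
have h0 B (B0 : 0 <= B) :
    spent_value ts B (Some None) <= pos_part (1 - B) * (D' - P')
  by case: (ih B B0).
have h1 B (B0 : 2 / 3 <= B) : spent_value ts B (Some None) <= pos_part (1 - B) * (D' - G').
  by case: (ih B) => [|/(_ B0)]; first lra.
have P0 : 0 <= D' - P'.
  have /(le_trans (spent_value_ge0 _ _ _)) := h0 0 (lexx _).
  by rewrite subr0 /pos_part maxEle ler10 mul1r.
have G0 : 0 <= D' - G'.
  have /(le_trans (spent_value_ge0 _ _ _)) := h1 (2 / 3) (lexx _).
  by rewrite pmulr_rge0// (lt_le_trans _ (pos_part_ge _))//; lra.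
have mark0 q : (if markable q then
       (spent_value ts (A + bid_frac q) (Some None) + spent_value ts A (Some None)) / 4 +
       marked_value ts A (bid_frac q) (Some None) / 2
     else halves q / 2 * spent_value ts (A + bid_frac q) (Some None) +
          (1 - halves q / 2) * spent_value ts A (Some None)) =
   halves q / 2 * spent_value ts (A + bid_frac q) (Some None) +
          (1 - halves q / 2) * spent_value ts A (Some None).
  by case: ifP => // /markable_halves [-> _] /=; field.
have xb q := pos_part_onemD A0 (bid_frac01 q).
rewrite /D /G /P no_gain_cons /= -/D' -/G' -/P'.
have bound v c w : spent_value ts A (Some None) <= v ->
    (forall q, spent_value ts (A + bid_frac q) (Some None) <= c q) ->
    (forall q, halves q / 2 * c q + (1 - halves q / 2) * v <= w q) ->
    forall q, halves q / 2 * spent_value ts (A + bid_frac q) (Some None) +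
          (1 - halves q / 2) * spent_value ts A (Some None) <= w q.
  move=> hv hc hw q; apply: le_trans (hw q).
  have /andP[l0 l1] := halves_ge0 q.
  by apply: lerD; apply: ler_wpM2l => //; rewrite subr_ge0.
split=> [A1|].
  rewrite [X in _ * X](_ : _ =
      D' - G' + (- (D' - G')) * load_at t + (- (D' - G')) * rs t + 0 * rs t); last by ring.
  rewrite spent_value_cons; apply: sum_pi_affine => q; rewrite {}mark0; move: q.
  apply: (bound (pos_part (1 - A) * (D' - G')) (fun q => pos_part (1 - A) * (D' - G') *
     (if bid_frac q < 2 / 3 then 1 - 3 / 2 * bid_frac q else 1 - bid_frac q))).
  - exact: h1.
  - move=> q; have /andP[b0 b1] := bid_frac01 q; case: ltP => bq.
      have := @spent_value_small ts A (bid_frac q) (Some None).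
      rewrite b0 ltW// => /(_ isT)/le_trans; apply.
      have -> : spent_value ts (A + 2 / 3) (Some None) = 0 by apply: value_full; lra.
      rewrite mulr0 addr0.
      by rewrite mulrC ler_wpM2r ?h1//; lra.
    apply: le_trans (h1 _ _) _; first by lra.
    by rewrite mulrAC ler_wpM2r.
  - by move=> q; rewrite /expected_frac /small_r; case: ltP => bq; rewrite /expected_frac; lra.
rewrite [X in _ * X](_ : _ =
      D' - P' + (- (D' - P')) * load_at t + (P' - G') * rs t + 0 * rs t); last by ring.
rewrite spent_value_cons; apply: sum_pi_affine => q; rewrite {}mark0; move: q.
apply: (bound (pos_part (1 - A) * (D' - P')) (fun q => pos_part (1 - A) *
   (if bid_frac q < 2 / 3 then
      (1 - 3 / 2 * bid_frac q) * (D' - P') + bid_frac q / 2 * (D' - G')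
    else (1 - bid_frac q) * (D' - P')))).
- exact: h0.
- move=> q; have /andP[b0 b1] := bid_frac01 q; case: ltP => bq.
    have := @spent_value_small ts A (bid_frac q) (Some None).
    rewrite b0 ltW// => /(_ isT)/le_trans; apply.
    have hA : spent_value ts (A + 2 / 3) (Some None) <= pos_part (1 - A) * (1 / 3) * (D' - G').
      apply: le_trans (h1 _ _) _; first by lra.
      apply: ler_wpM2r => //; have := @pos_part_onemD A (2 / 3) A0.
      by rewrite (_ : 1 - 2 / 3 = 1 / 3 :> R); [apply; lra|field].
    have e1 : (1 - 3 / 2 * bid_frac q) * spent_value ts A (Some None) <=
        (1 - 3 / 2 * bid_frac q) * (pos_part (1 - A) * (D' - P')).
      by rewrite ler_wpM2l ?h0//; lra.
    have e2 : 3 / 2 * bid_frac q * spent_value ts (A + 2 / 3) (Some None) <=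
        3 / 2 * bid_frac q * (pos_part (1 - A) * (1 / 3) * (D' - G')).
      by rewrite ler_wpM2l// mulr_ge0.
    lra.
  apply: le_trans (h0 _ _) _; first by rewrite addr_ge0.
  by rewrite mulrA ler_wpM2r.
- by move=> q; rewrite /expected_frac /small_r; case: ltP => bq; rewrite /expected_frac; lra.
Qed.

Lemma sum_pi_ge0 t (f : outcome -> R) : (forall q, 0 <= f q) -> 0 <= \sum_q pi t q * f q.
Proof. by move=> f0; apply: sumr_ge0 => q _; rewrite mulr_ge0. Qed.

Lemma mark_r_ge0 q : 0 <= mark_r q.
Proof. by rewrite /mark_r; case: ifP => // _; have := bid_frac01 q; lra. Qed.

Lemma mark_m_ge0 q : 0 <= mark_m q.
Proof. by rewrite /mark_m; case: ifP => // _; have := bid_frac01 q; lra. Qed.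

Lemma mark_m_le q : mark_m q <= 2 * mark_r q.
Proof.
rewrite /mark_m /mark_r; case: ifP => [/markable_halves[_ ?]|_]; last by rewrite mulr0.
by lra.
Qed.

Lemma expected_frac_ge0 q : 0 <= expected_frac q.
Proof. by rewrite mulr_ge0//; have := halves_ge0 q; have := bid_frac01 q; lra. Qed.

Lemma expected_frac_mark_m_le1 q : expected_frac q + mark_m q <= 1.
Proof.
have /andP[b0 b1] := bid_frac01 q; have /andP[h0 h1] := halves_ge0 q.
rewrite /expected_frac /mark_m; case: ifP => [/markable_halves[-> _]|_]; first by lra.
by rewrite addr0; nra.
Qed.

Lemma mark_r_le q : 2 * mark_r q <= expected_frac q.
Proof.
rewrite /mark_r; case: ifP => [mq|_]; last by rewrite mulr0 expected_frac_ge0.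
by have [h _] := markable_halves mq; rewrite /expected_frac h; lra.
Qed.

Lemma small_r_ge0 q : 0 <= small_r q.
Proof. by rewrite /small_r; case: ifP => // _; have := expected_frac_ge0 q; lra. Qed.

Lemma expected_frac_small_r_le1 q : expected_frac q + small_r q <= 1.
Proof.
have /andP[b0 b1] := bid_frac01 q; have /andP[h0 h1] := halves_ge0 q.
rewrite /small_r; case: ifP => bq; rewrite /expected_frac; last by rewrite addr0; nra.
have : halves q / 2 * bid_frac q <= 1 * bid_frac q by rewrite ler_wpM2r.
lra.
Qed.

Lemma small_r_le q : 2 * small_r q <= expected_frac q.
Proof. by have := expected_frac_ge0 q; rewrite /small_r; case: ifP => _; lra. Qed.

Definition initial_marks : marks_of := [ffun=> None].

Lemma value_le_spent ts A v : v = None \/ v = Some None ->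
  value ts A initial_marks <= spent_value ts A v.
Proof.
case=> ->.
  apply: le_trans (value_saturate _ _ (predC1 (Some j))) _.
  rewrite le_eqVlt; apply/orP; left; apply/eqP; congr value.
  by apply/ffunP => k; rewrite !ffunE inE; case: eqP.
apply: le_trans (value_saturate _ _ predT) _.
rewrite le_eqVlt; apply/orP; left; apply/eqP; congr value.
by apply/ffunP => k; rewrite !ffunE inE; case: eqP.
Qed.

Lemma value_le_gain_mark ts : \sum_(t <- ts) r t <= 1 / 2 ->
  value ts 0 initial_marks <= expR (- \sum_(t <- ts) load_at t) *
    (1 - ((\sum_(t <- ts) r t) ^+ 2 / 2 - 2 / 3 * (\sum_(t <- ts) r t) ^+ 3)).
Proof.
move=> Rle; apply: le_trans (value_le_spent _ _ (or_introl erefl)) _.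
have [_ _ _] := spent_value_le_mark ts (lexx 0).
rewrite subr0 [pos_part 1](_ : _ = 1) ?mul1r; last by rewrite /pos_part maxEle ler10.
move/le_trans; apply; apply: gain_le => // t.
- exact: sum_pi_ge0 mark_r_ge0.
- exact: sum_pi_ge0 mark_m_ge0.
- rewrite mulr_sumr; apply: ler_sum => q _.
  by rewrite mulrCA ler_wpM2l// mark_m_le.
- rewrite /load_at -big_split/= -[leRHS](pi_sum1 t); apply: ler_sum => q _.
  by rewrite -mulrDr ler_piMr// expected_frac_mark_m_le1.
- rewrite mulr_sumr; apply: ler_sum => q _.
  by rewrite mulrCA ler_wpM2l// mark_r_le.
Qed.

Lemma value_le_gain_small ts : \sum_(t <- ts) rs t <= 1 / 2 ->
  value ts 0 initial_marks <= expR (- \sum_(t <- ts) load_at t) *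
    (1 - ((\sum_(t <- ts) rs t) ^+ 2 / 2 - 2 / 3 * (\sum_(t <- ts) rs t) ^+ 3)).
Proof.
move=> Rle; apply: le_trans (value_le_spent _ _ (or_intror erefl)) _.
have [_] := spent_value_le_small ts (lexx 0).
rewrite subr0 [pos_part 1](_ : _ = 1) ?mul1r; last by rewrite /pos_part maxEle ler10.
move/le_trans; apply; apply: gain_le => // t.
- exact: sum_pi_ge0 small_r_ge0.
- exact: sum_pi_ge0 small_r_ge0.
- by rewrite mulr2n mulrDl mul1r lerDl; exact: sum_pi_ge0 small_r_ge0.
- rewrite /load_at -big_split/= -[leRHS](pi_sum1 t); apply: ler_sum => q _.
  by rewrite -mulrDr ler_piMr// expected_frac_small_r_le1.
- rewrite mulr_sumr; apply: ler_sum => q _.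
  by rewrite mulrCA ler_wpM2l// small_r_le.
Qed.

Lemma value_le_expR_square ts : value ts 0 initial_marks <=
  expR (- (\sum_(t <- ts) load_at t + \sum_(t <- ts) load_at t ^+ 2 / 2)).
Proof.
apply: le_trans (value_le_spent _ _ (or_intror erefl)) _.
have [+ _ _ _] := spent_value_le_mark ts (lexx 0).
rewrite subr0 [pos_part 1](_ : _ = 1) ?mul1r; last by rewrite /pos_part maxEle ler10.
move/le_trans; apply.
apply: (@no_gain_le_expR _ _ load_at (fun=> 0) (fun=> 0)) => // t.
- rewrite addr0 /load_at -[leRHS](pi_sum1 t); apply: ler_sum => q _.
  rewrite ler_piMr//; apply: le_trans (expected_frac_mark_m_le1 q).
  by rewrite lerDl mark_m_ge0.
- by rewrite mulr0; exact: sum_pi_ge0 expected_frac_ge0.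
Qed.

Definition one_way_large (q : outcome) : R :=
  if q is Some (i, (a, a')) then
    if [&& a == Some j, a' == Some j & 2 / 3 <= beta i] then beta i else 0
  else 0.

Lemma expected_frac_split q :
  expected_frac q = one_way_large q + 2 * mark_r q + 2 * small_r q.
Proof.
rewrite /small_r /mark_r /expected_frac; case: q => [[i [a a']]|] /=; last by case: ltP => _; lra.
by rewrite ltNge; case: (_ == _); case: (_ == _) => /=; case: leP => _ /=; field.
Qed.

Lemma value_le_of_one_way ts (y := \sum_(t <- ts) load_at t) :
  y <= 1 -> \sum_(t <- ts) \sum_q pi t q * one_way_large q <= 417 / 1000 ->
  value ts 0 initial_marks <= expR (- y) * (1 - pos_part (y - 417 / 1000) ^+ 2 / 64).
Proof.
move=> y1 owle.
have ysplit : y = \sum_(t <- ts) \sum_q pi t q * one_way_large q +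
    2 * (\sum_(t <- ts) r t) + 2 * (\sum_(t <- ts) rs t).
  rewrite /y !mulr_sumr -!big_split/=; apply: eq_bigr => t _.
  rewrite !mulr_sumr -!big_split/=; apply: eq_bigr => q _.
  by rewrite expected_frac_split; ring.
have rge0 : 0 <= \sum_(t <- ts) r t.
  by apply: sumr_ge0 => t _; exact: sum_pi_ge0 mark_r_ge0.
have rsge0 : 0 <= \sum_(t <- ts) rs t.
  by apply: sumr_ge0 => t _; exact: sum_pi_ge0 small_r_ge0.
have ow0 : 0 <= \sum_(t <- ts) \sum_q pi t q * one_way_large q.
  apply: sumr_ge0 => t _; apply: sum_pi_ge0 => -[[i [a a']]|] //=.
  by case: ifP.
have rle : \sum_(t <- ts) r t <= 1 / 2 by lra.
have rsle : \sum_(t <- ts) rs t <= 1 / 2 by lra.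
have := value_le_gain_mark rle; have := value_le_gain_small rsle; rewrite -/y.
move: rge0 rsge0 ow0 rle rsle ysplit owle.
move: (\sum_(t <- ts) r t) (\sum_(t <- ts) rs t) => S1 S2.
move=> r0 rs0 ow0 rle rsle ysplit owle hs hm.
have e0 := expR_ge0 (- y).
pose h := pos_part (y - 417 / 1000) / 4.
have -> : pos_part (y - 417 / 1000) ^+ 2 / 64 = h ^+ 2 / 4 by rewrite /h; field.
have h0 : 0 <= h by rewrite divr_ge0 ?pos_part_ge0.
have h1 : h <= 3 / 20 by rewrite /h ler_pdivrMr//; apply: pos_part_le; lra.
have key (x : R) : h <= x -> x <= 1 / 2 -> h ^+ 2 / 4 <= x ^+ 2 / 2 - 2 / 3 * x ^+ 3.
  move=> hx xle.
  have -> : x ^+ 2 / 2 - 2 / 3 * x ^+ 3 = x ^+ 2 * (1 / 2 - 2 / 3 * x) by field.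
  have hhx : h ^+ 2 <= x ^+ 2 by rewrite lerXn2r ?nnegrE//; lra.
  have [x38|x38] := leP x (3 / 8).
    have : x ^+ 2 * (1 / 4) <= x ^+ 2 * (1 / 2 - 2 / 3 * x) by rewrite ler_wpM2l ?sqr_ge0//; lra.
    lra.
  have : x ^+ 2 * (1 / 6) <= x ^+ 2 * (1 / 2 - 2 / 3 * x) by rewrite ler_wpM2l ?sqr_ge0//; lra.
  have : h ^+ 2 <= (3 / 20) ^+ 2 by rewrite lerXn2r ?nnegrE//; lra.
  have : (3 / 8) ^+ 2 <= x ^+ 2 by rewrite lerXn2r ?nnegrE//; lra.
  lra.
have [hS|hS] := leP h S1.
  by apply: (le_trans hm); rewrite ler_wpM2l// lerD2l lerN2 key.
have [hS2|hS2] := leP h S2.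
  by apply: (le_trans hs); rewrite ler_wpM2l// lerD2l lerN2 key.
have : h <= (y - 417 / 1000) / 4 \/ h = 0.
  by rewrite /h /pos_part maxEle; case: ifP => _; [right; rewrite mul0r|left].
by case; lra.
Qed.

End AgentProcess.

(** * Type decomposition *)

Section Intervals.
Context {R : realType}.

Lemma lebesgue_measure_itv_co (a b : R) :
  lebesgue_measure `[a, b[%classic = (Num.max (b - a) 0)%:E.
Proof.
rewrite lebesgue_measure_itv/= lte_fin; case: ltP => ab.
  by rewrite -EFinB maxEle leNgt subr_gt0 ab.
by rewrite maxEle subr_le0 ab.
Qed.

Lemma itv_co_setI_half (a b : R) :
  `[a, b[%classic `&` half_interval = `[Num.max a 0, Num.min b 2^-1[%classic :> set R.
Proof.
apply/seteqP; split=> e; rewrite /half_interval/= !in_itv/= ge_max lt_min.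
  by move=> [/andP[-> ->] /andP[-> ->]].
by move=> /andP[/andP[-> ->] /andP[-> ->]].
Qed.

End Intervals.

Section Decomposition.
Context {R : realType} {I J : finType} {T : nat}.
Variables (ord : seq J) (mu : 'I_T -> I -> J -> R).
Hypothesis ord_agents : perm_eq ord (enum J).
Hypothesis mu_ge0 : forall t i j, 0 <= mu t i j.

Lemma left_end_ge0 t i j : 0 <= left_end ord mu t i j.
Proof. by rewrite /left_end sumr_ge0. Qed.

Let ord_mem j : j \in ord. Proof. by rewrite (perm_mem ord_agents) mem_enum. Qed.

Lemma right_end_take t i j : left_end ord mu t i j + mu t i j =
  \sum_(j' <- take (index j ord).+1 ord) mu t i j'.
Proof.
rewrite (take_nth j) ?index_mem// -cats1 big_cat/= big_seq1 nth_index//.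
Qed.

Lemma sum_take_le t i (n n' : nat) : (n <= n')%N ->
  \sum_(j' <- take n ord) mu t i j' <= \sum_(j' <- take n' ord) mu t i j'.
Proof.
move=> nn'; rewrite -(subnKC nn') takeD big_cat/= lerDl sumr_ge0//.
Qed.

Lemma right_end_le t i j : left_end ord mu t i j + mu t i j <= \sum_j' mu t i j'.
Proof.
rewrite right_end_take.
have -> : \sum_j' mu t i j' = \sum_(j' <- take (size ord) ord) mu t i j'.
  by rewrite take_size (perm_big _ ord_agents)/= big_enum.
by apply: sum_take_le; rewrite index_mem.
Qed.

Lemma agent_interval_inj t i j j' e :
  e \in agent_interval ord mu t i j -> e \in agent_interval ord mu t i j' -> j = j'.
Proof.
wlog ij : j j' / (index j ord <= index j' ord)%N.
  by move=> h; case/orP: (leq_total (index j ord) (index j' ord)) => /h h'; [|move=> + +; move=> ? ?; apply/esym]; apply: h'.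
rewrite !in_itv/= => /andP[_ ej] /andP[ej' _].
have [lij|lji|eij] := ltngtP (index j ord) (index j' ord).
- have := sum_take_le t i lij; rewrite -right_end_take => h.
  by have := le_lt_trans (le_trans h ej') ej; rewrite ltxx.
- by move: ij; rewrite leqNgt lji.
by rewrite -(nth_index j (ord_mem j)) eij nth_index.
Qed.

Lemma agent_at_eq t i e j :
  (agent_at ord mu t i e == Some j) = (e \in agent_interval ord mu t i j).
Proof.
rewrite /agent_at; case: pickP => [j' ej'|none]; last by rewrite none.
apply/eqP/idP => [[<-]//|ej]; congr Some; exact: agent_interval_inj ej' ej.
Qed.

Definition agents_at t i (e : R) : agent J * agent J :=
  (agent_at ord mu t i e, agent_at ord mu t i (e + 2^-1)).

Lemma measurable_agent_at t i a : measurable [set e | agent_at ord mu t i e = a].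
Proof.
have mj j : measurable [set e | e \in agent_interval ord mu t i j] by exact: measurable_itv.
case: a => [j|].
  rewrite (_ : [set _ | _] = [set e | e \in agent_interval ord mu t i j])//.
  by apply/seteqP; split=> e /=; rewrite -agent_at_eq => /eqP.
rewrite (_ : [set _ | _] =
    \bigcap_(j in [set: J]) ~` [set e | e \in agent_interval ord mu t i j]).
  by apply: fin_bigcap_measurable => // j _; apply: measurableC.
apply/seteqP; split=> e /=; rewrite /agent_at.
  by case: pickP => // none _ j _ /=; rewrite none.
by case: pickP => // j ej /(_ j Logic.I).
Qed.

Lemma measurable_agents_at t i aa : measurable [set e | agents_at t i e = aa].
Proof.
case: aa => a a'.
rewrite (_ : [set _ | _] = [set e | agent_at ord mu t i e = a] `&`
   (fun e => e + 2^-1) @^-1` [set e | agent_at ord mu t i e = a']); last first.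
  by apply/seteqP; split=> e /=; rewrite /agents_at => -[-> ->].
apply: measurableI; first exact: measurable_agent_at.
rewrite -[X in measurable X]setTI.
have mf : measurable_fun [set: R] (fun e : R => e + 2^-1) by exact: measurable_funD.
by apply: mf => //; exact: measurable_agent_at.
Qed.

Lemma agents_at_halves t i j :
  \sum_j' mu t i j' <= 1 ->
  (2%:E * lebesgue_measure ([set e | (agents_at t i e).1 = Some j] `&` half_interval) +
   2%:E * lebesgue_measure ([set e | (agents_at t i e).2 = Some j] `&` half_interval)
   = (2 * mu t i j)%:E)%E.
Proof.
move=> mu1; have L0 := left_end_ge0 t i j; have LM := right_end_le t i j.
have m0 := mu_ge0 t i j; set L := left_end ord mu t i j in L0 LM *.
have -> : [set e | (agents_at t i e).1 = Some j] = `[L, L + mu t i j[%classic.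
  by apply/seteqP; split=> e /=; rewrite -[e \in _]agent_at_eq => /eqP.
have -> : [set e | (agents_at t i e).2 = Some j] = `[L - 2^-1, L + mu t i j - 2^-1[%classic.
  apply/seteqP; split=> e /=.
    by move/eqP; rewrite agent_at_eq !in_itv/= -/L lerBlDr ltrBrDr.
  by rewrite in_itv/= lerBlDr ltrBrDr => h; apply/eqP; rewrite agent_at_eq in_itv.
rewrite !itv_co_setI_half !lebesgue_measure_itv_co -!EFinM -EFinD; congr EFin.
rewrite !maxEle !minEle.
by repeat case: ifPn; rewrite -?ltNge => *; lra.
Qed.

Lemma agents_at_both t i j :
  \sum_j' mu t i j' <= 1 ->
  (2%:E * lebesgue_measure ([set e | agents_at t i e = (Some j, Some j)] `&` half_interval)
   <= (Num.max (2 * mu t i j - 1) 0)%:E)%E.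
Proof.
move=> mu1; have L0 := left_end_ge0 t i j; have LM := right_end_le t i j.
have m0 := mu_ge0 t i j; set L := left_end ord mu t i j in L0 LM *.
pose M := L + mu t i j - 2^-1.
apply: (@le_trans _ _ (2%:E * lebesgue_measure (`[L, M[%classic : set R))%E).
  rewrite lee_pmul2l// ?fin_numE//; apply: le_measure; rewrite ?inE.
  - apply: measurableI; first exact: measurable_agents_at.
    exact: measurable_itv.
  - exact: measurable_itv.
  move=> e /= [[/eqP e1 /eqP e2] _]; move: e1 e2; rewrite !agent_at_eq !in_itv/= -/L.
  by move=> /andP[-> _] /andP[_ ?]; rewrite /M ltrBrDr.
rewrite lebesgue_measure_itv_co -EFinM lee_fin !maxEle /M.
by repeat case: ifPn; rewrite -?ltNge => *; lra.
Qed.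

End Decomposition.

(** * Expectation of finitely-valued variables *)

Section FiniteExpectation.
Context {R : realType} {d : measure_display} {Omega : measurableType d}.
Variables (P : probability Omega R) (F : finType) (Y : Omega -> F).
Hypothesis mY : forall y, measurable (Y @^-1` [set y]).

Lemma expectation_finite (h : F -> R) : (forall y, 0 <= h y) ->
  'E_P[fun w => h (Y w)]%E = (\sum_y h y * fine (P (Y @^-1` [set y])))%:E.
Proof.
move=> h0; rewrite unlock.
transitivity (\int[P]_w (\sum_(y <- enum F) ((h y)%:E * (\1_(Y @^-1` [set y]) w)%:E)))%E.
  apply: eq_integral => w _; rewrite big_enum/= (bigD1 (Y w))//=.
  rewrite indicE mem_set//= mule1 big1 ?adde0// => y yY.
  by rewrite indicE memNset ?mule0//= => /esym/eqP; rewrite (negbTE yY).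
rewrite ge0_integral_sum//; last 2 first.
  by move=> y; apply: measurable_funeM; apply/measurable_EFinP; exact: measurable_indic.
  by move=> y w _; rewrite mule_ge0// lee_fin.
rewrite big_enum/= -sumEFin; apply: eq_bigr => y _.
rewrite ge0_integralZl_EFin//; last first.
  by apply/measurable_EFinP; exact: measurable_indic.
by rewrite integral_indic// setIT EFinM fineK// fin_num_measure.
Qed.

Lemma probability_finite (B : pred F) :
  P [set w | B (Y w)] = (\sum_(y | B y) fine (P (Y @^-1` [set y])))%:E.
Proof.
have mB : measurable [set w | B (Y w)].
  rewrite (_ : [set _ | _] = \bigcup_(y in [set` B]) Y @^-1` [set y]).
    by apply: fin_bigcup_measurable => //; exact: finite_finset.
  by apply/seteqP; split=> [w BY|w [y By /= ->]]//=; exists (Y w).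
rewrite -expectation_indic//.
have -> : \1_[set w | B (Y w)] = (fun w => (B (Y w))%:R) :> (Omega -> R).
  apply/funext => w; rewrite indicE; congr (_%:R).
  by case: (boolP (B (Y w))) => BY; [rewrite mem_set|rewrite memNset//; exact/negP].
rewrite (expectation_finite (h := fun y => (B y)%:R))//; congr EFin.
rewrite [RHS]big_mkcond; apply: eq_bigr => y _.
by case: (B y); rewrite ?mul1r ?mul0r.
Qed.

Lemma probability_finite_sum1 : \sum_y fine (P (Y @^-1` [set y])) = 1.
Proof.
apply: EFin_inj; rewrite -(probability_finite predT) -(@probability_setT _ _ _ P).
by congr (P _); apply/seteqP.
Qed.

End FiniteExpectation.

(** * Reduction to the process of one agent *)

Section Simulation.
Context {R : realType} {I J : finType} {T : nat} (W : adwords R I J T) (j : J).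

Definition bid_ratio (i : I) : R := bid W i j / budget W j.

Definition marks_at (i : I) (m : agent J) : bool := 2 / 3 * xbudget W m <= xbid W i m.

Lemma bid_ratio_ge0 i : 0 <= bid_ratio i.
Proof. by rewrite divr_ge0 ?bid_ge0// ltW// budget_gt0. Qed.

Lemma bid_ratio_le1 i : bid_ratio i <= 1.
Proof. by rewrite ler_pdivrMr ?budget_gt0// mul1r bid_le_budget. Qed.

Lemma marks_at_agent i : marks_at i (Some j) = (2 / 3 <= bid_ratio i).
Proof. by rewrite /marks_at /= /bid_ratio ler_pdivlMr ?budget_gt0. Qed.

Definition mark_states (h : seq (event I J)) : {ffun agent J -> mark_state} :=
  [ffun m => match marked_selections h m with
             | [::] => None
             | [:: s] => Some (Some (s == m))
             | _ => Some None
             end].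

Definition alloc_ratio (h : seq (event I J)) : R :=
  \sum_(e <- h | selected e == Some j) bid_ratio (item e).

Lemma alloc_ratio_rcons h e :
  alloc_ratio (rcons h e) = alloc_ratio h + gain bid_ratio j (item e) (selected e).
Proof.
by rewrite /alloc_ratio /gain -cats1 big_cat/= big_cons big_nil; case: ifP; rewrite ?addr0.
Qed.

Lemma mark_states_rcons h e : mark_states (rcons h e) =
  if mark e is Some m then
    set_mark (mark_states h) m (next_mark (mark_states h m) (selected e == m))
  else mark_states h.
Proof.
have ms m : marked_selections (rcons h e) m =
    marked_selections h m ++ (if mark e == Some m then [:: selected e] else [::]).
  rewrite /marked_selections -cats1 filter_cat map_cat /=.
  by case: ifP.
case me : (mark e) => [m|]; apply/ffunP => m'; rewrite !ffunE ms me; last by rewrite cats0.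
rewrite (inj_eq Some_inj) eq_sym; case: eqP => [->|_]; last by rewrite cats0.
by case: (marked_selections h m) => [|s [|s' l]].
Qed.

Definition history_step (h : seq (event I J)) (q : option (I * (agent J * agent J)))
    (mcoin scoin : bool) : seq (event I J) :=
  if q is Some (i, (a, a')) then
    rcons h (socs_step W h (if a == a' then OneWay i a else TwoWay i a a') mcoin scoin)
  else h.

Lemma history_agent_step h q mcoin scoin :
  let h' := history_step h q mcoin scoin in
  (alloc_ratio h', mark_states h') =
  agent_step bid_ratio marks_at j q mcoin scoin (alloc_ratio h, mark_states h).
Proof.
case: q => [[i [a a']]|] //=; rewrite alloc_ratio_rcons mark_states_rcons.
case: ifP => _ //=; rewrite /two_way_socs /marks_at.
case: ifP => _ //=; rewrite !ffunE.
by case: (marked_selections h _) => [|s [|s' l]].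
Qed.

End Simulation.

Section Law.
Context {R : realType} {I J : finType} {T : nat} (W : adwords R I J T).
Context {d : measure_display} {Omega : measurableType d} {P : probability Omega R}.
Variables (rnd : randomness W P) (ord : seq J) (mu : 'I_T -> I -> J -> R).
Hypothesis ord_agents : perm_eq ord (enum J).
Hypothesis mu_ge0 : forall t i j, 0 <= mu t i j.

Local Notation outcome := (option (I * (agent J * agent J))).
Local Notation outcomes := {ffun 'I_T -> outcome * (bool * bool)}.

Definition arrival_outcome t w : outcome :=
  omap (fun i => (i, agents_at ord mu t i (Defs.eta rnd t w))) (arrival rnd t w).

Definition run_outcomes w : outcomes :=
  [ffun t => (arrival_outcome t w, (mark_coin rnd t w, select_coin rnd t w))].

Definition agents_law t i aa : R :=
  fine (P (Defs.eta rnd t @^-1` [set e | agents_at ord mu t i e = aa])).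

Definition arrival_outcome_law t (q : outcome) : R :=
  match q with
  | Some (i, aa) => arrival_rate W t i * agents_law t i aa
  | None => fine (P (arrival rnd t @^-1` [set None]))
  end.

Definition outcome_event (q : outcome) : set (option I) := [set omap fst q].

Definition outcome_eta t (q : outcome) : set R :=
  if q is Some (i, aa) then [set e | agents_at ord mu t i e = aa] else [set: R].

Let measurable_outcome_eta t q : measurable (outcome_eta t q).
Proof. by case: q => [[i aa]|] //=; exact: measurable_agents_at. Qed.

Lemma run_outcomes_preimage (x : outcomes) : run_outcomes @^-1` [set x] =
  \bigcap_(t in [set: 'I_T])
    (arrival rnd t @^-1` outcome_event (x t).1
     `&` Defs.eta rnd t @^-1` outcome_eta t (x t).1
     `&` mark_coin rnd t @^-1` [set (x t).2.1]
     `&` select_coin rnd t @^-1` [set (x t).2.2]).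
Proof.
apply/seteqP; split=> w /=.
  move=> <- t _; rewrite !ffunE /= /arrival_outcome /outcome_event /outcome_eta.
  by split=> //; split=> //; split; case: (arrival rnd t w).
move=> xw; apply/ffunP => t; rewrite ffunE.
have [[[+ +] /= ->] ->] := xw t Logic.I.
case: (x t) => q [mc sc] /=; rewrite /outcome_event /outcome_eta /arrival_outcome /=.
by case: q => [[i aa]|] /= -> //= ->.
Qed.

Lemma mark_coin_half t b : P (mark_coin rnd t @^-1` [set b]) = (2^-1)%:E.
Proof.
case: b; first exact: mark_coin_law.
have -> : mark_coin rnd t @^-1` [set false] = ~` [set w | mark_coin rnd t w = true].
  by apply/seteqP; split=> w /=; case: (mark_coin rnd t w).
rewrite probability_setC; last exact: (measurable_funPTI (mark_coin rnd t) (Y := [set true])).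
by rewrite mark_coin_law -EFinB; congr EFin; field.
Qed.

Lemma select_coin_half t b : P (select_coin rnd t @^-1` [set b]) = (2^-1)%:E.
Proof.
case: b; first exact: select_coin_law.
have -> : select_coin rnd t @^-1` [set false] = ~` [set w | select_coin rnd t w = true].
  by apply/seteqP; split=> w /=; case: (select_coin rnd t w).
rewrite probability_setC; last exact: (measurable_funPTI (select_coin rnd t) (Y := [set true])).
by rewrite select_coin_law -EFinB; congr EFin; field.
Qed.

Lemma measurable_run_outcomes x : measurable (run_outcomes @^-1` [set x]).
Proof.
rewrite run_outcomes_preimage; apply: fin_bigcap_measurable => // t _.
apply: measurableI; last exact: measurable_funPTI.
apply: measurableI; last exact: measurable_funPTI.
apply: measurableI; first exact: arrival_measurable.
by apply: measurable_funPTI; exact: measurable_outcome_eta.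
Qed.

Lemma run_outcomes_law x : P (run_outcomes @^-1` [set x]) =
  (\prod_t outcome_law arrival_outcome_law t (x t))%:E.
Proof.
rewrite run_outcomes_preimage randomness_independent => [|t]; last exact: measurable_outcome_eta.
rewrite -prodEFin; apply: eq_bigr => t _.
rewrite mark_coin_half select_coin_half /outcome_law /arrival_outcome_law.
rewrite /outcome_event /outcome_eta.
case: (x t) => [[[i aa]|] [mc sc]] /=.
  rewrite [P (arrival _ _ @^-1` _)](arrival_law rnd t i).
  rewrite -(fineK (fin_num_measure P _ _)); last first.
    by apply: measurable_funPTI; exact: measurable_agents_at.
  by rewrite -!EFinM; congr EFin; rewrite /agents_law; field.
rewrite preimage_setT probability_setT mule1.
rewrite -[X in (X * _ * _)%E](fineK (fin_num_measure P _ _)); last exact: arrival_measurable.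
by rewrite -!EFinM; congr EFin; field.
Qed.

Lemma arrival_outcome_law_ge0 t q : 0 <= arrival_outcome_law t q.
Proof.
case: q => [[i aa]|] /=; last by rewrite fine_ge0.
by rewrite mulr_ge0 ?arrival_rate_ge0// /agents_law fine_ge0.
Qed.

Lemma measurable_agents_preimage t i aa :
  measurable ((fun w => agents_at ord mu t i (Defs.eta rnd t w)) @^-1` [set aa]).
Proof.
exact: (measurable_funPTI (Defs.eta rnd t) (measurable_agents_at ord_agents mu_ge0 t i aa)).
Qed.

Lemma agents_law_sum1 t i : \sum_aa agents_law t i aa = 1.
Proof. by rewrite -(probability_finite_sum1 P (measurable_agents_preimage t i)). Qed.

Lemma arrival_outcome_law_sum1 t : \sum_q arrival_outcome_law t q = 1.
Proof.
rewrite -[RHS](probability_finite_sum1 P (Y := arrival rnd t)) => [|q]; last first.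
  exact: arrival_measurable.
have sum_option (V : nmodType) (A : finType) (f : option A -> V) :
    \sum_q f q = f None + \sum_a f (Some a).
  rewrite (bigD1 None)//=; congr (_ + _).
  rewrite (reindex_omap Some id)/=; last by case.
  by apply: eq_bigl => a; rewrite eqxx.
rewrite !sum_option /=; congr (_ + _).
rewrite sum_pair; apply: eq_bigr => i _ /=.
rewrite -mulr_sumr agents_law_sum1 mulr1.
by rewrite [P _](arrival_law rnd t i).
Qed.

Lemma expectation_run (St : Type) (step : 'I_T -> St -> outcome * (bool * bool) -> St)
    (F : St -> R) (st0 : St) : (forall st, 0 <= F st) ->
  'E_P[fun w => F (foldl (fun st t => step t st (run_outcomes w t)) st0 (enum 'I_T))]%E =
  (iter_exp (outcome_law arrival_outcome_law) step F (enum 'I_T) st0)%:E.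
Proof.
move=> F0.
rewrite (expectation_finite P measurable_run_outcomes
  (h := fun x => F (foldl (fun st t => step t st (x t)) st0 (enum 'I_T))))//.
congr EFin.
have := sum_ffun_iter_exp (outcome_law arrival_outcome_law) step F id st0.
rewrite map_id => <-; apply: eq_bigr => x _.
by rewrite run_outcomes_law/= mulrC.
Qed.

Lemma general_socs_foldl w : general_socs rnd ord mu w =
  foldl (fun h t => history_step W h (run_outcomes w t).1 (run_outcomes w t).2.1
                      (run_outcomes w t).2.2) [::] (enum 'I_T).
Proof.
rewrite /general_socs; elim: (enum _) [::] => //= t s ih h; rewrite ih; congr foldl.
rewrite ffunE /arrival_outcome /history_step /=.
by case: (arrival rnd t w) => [i|] //=; rewrite /decompose; case: ifP.
Qed.

Lemma expectation_shortfall j :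
  'E_P[fun w => pos_part (1 - allocated_bid rnd ord mu j w / budget W j)]%E =
  (value (bid_ratio W j) (marks_at W) j arrival_outcome_law (enum 'I_T) 0
     initial_marks)%:E.
Proof.
rewrite /value -expectation_run => [|st]; last exact: pos_part_ge0.
congr expectation; apply/funext => w; congr (pos_part (1 - _)).
rewrite /allocated_bid mulr_suml general_socs_foldl -/(alloc_ratio W j _).
have -> : (0 : R, @initial_marks J) = (alloc_ratio W j [::], @mark_states I J [::]).
  by rewrite /alloc_ratio big_nil; congr (_, _); apply/ffunP => m; rewrite !ffunE.
elim: (enum _) [::] => //= t s ih h.
by rewrite -history_agent_step ih.
Qed.

End Law.

(** * One-way load and the LP constraints *)

Section OneWayMass.
Context {R : realType} {T : nat}.

Lemma one_way_mass_le (F Y M l : 'I_T -> R) (v : R) :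
  (forall t, 0 <= F t) -> (forall t, 2 / 3 * F t <= Y t <= F t) ->
  (forall t, Y t / 2 <= M t <= Y t) -> (forall t, M t <= l t) ->
  \sum_t l t ^+ 2 <= 1 / 93 ->
  \prod_t (1 - F t) * (1 + \sum_t F t - \sum_t Y t) <= v ->
  \sum_t M t <= 1 - v ->
  2 * \sum_t M t - \sum_t Y t <= 417 / 1000.
Proof.
move=> F0 FY YM Ml l2 hv hM.
have [Ysmall|Ybig] := leP (\sum_t Y t) (417 / 1000).
  have : \sum_t M t <= \sum_t Y t by apply: ler_sum => t _; case/andP: (YM t).
  lra.
have F2l t : F t ^+ 2 <= 9 * l t ^+ 2.
  have -> : 9 * l t ^+ 2 = (3 * l t) ^+ 2 by ring.
  rewrite lerXn2r ?nnegrE//; have := F0 t; have := FY t; have := YM t; have := Ml t; lra.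
have F2 : \sum_t F t ^+ 2 <= 9 / 93.
  apply: (@le_trans _ _ (\sum_t 9 * l t ^+ 2)); first exact: ler_sum.
  by rewrite -mulr_sumr; lra.
have Fle t : F t <= 39 / 125.
  have : F t ^+ 2 <= 9 / 93.
    apply: le_trans F2; rewrite (bigD1 t)//= lerDl sumr_ge0// => *; exact: sqr_ge0.
  move=> h; rewrite leNgt; apply/negP => h'.
  have : (39 / 125) ^+ 2 <= F t ^+ 2 by rewrite lerXn2r ?nnegrE// ?ltW//; lra.
  lra.
set SF := \sum_t F t in hv *; set SY := \sum_t Y t in hv Ybig *.
have prodF : expR (- SF) * (29 / 31) <= \prod_t (1 - F t).
  apply: (@le_trans _ _ (\prod_t expR (- (F t + 2 / 3 * F t ^+ 2)))).
    rewrite -expR_sum sumrN big_split/= -mulr_sumr opprD expRD -/SF.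
    apply: ler_wpM2l; first exact: expR_ge0.
    by apply: le_trans (expR_ge1Dx _); lra.
  by apply: ler_prod => t _; rewrite expR_ge0 onem_ge_expR// F0 Fle.
have SFY : SY <= SF by apply: ler_sum => t _; case/andP: (FY t).
have SYF : SF <= 3 / 2 * SY.
  rewrite /SF /SY mulr_sumr; apply: ler_sum => t _.
  by case/andP: (FY t) => h _; lra.
have tilt : expR (- (3 / 2 * SY)) * (1 + SY / 2) <= expR (- SF) * (1 + SF - SY).
  have -> : - SF = - (3 / 2 * SY) + (3 / 2 * SY - SF) by ring.
  rewrite expRD -[leRHS]mulrA; apply: ler_wpM2l; first exact: expR_ge0.
  apply: (@le_trans _ _ ((1 + (3 / 2 * SY - SF)) * (1 + SF - SY))); last first.
    by apply: ler_wpM2r (expR_ge1Dx _); lra.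
  have : 0 <= (3 / 2 * SY - SF) * (SF - SY) by rewrite mulr_ge0// subr_ge0.
  lra.
have := one_way_expR_bound (ltW Ybig).
have : expR (- SF) * (29 / 31) * (1 + SF - SY) <= v.
  by apply: le_trans hv; apply: ler_wpM2r prodF; lra.
lra.
Qed.

Lemma expR_square_le (y s : R) : y <= 1 -> 1 / 93 <= s ->
  expR (- (y + s / 2)) <= expR (- y) * (1 - pos_part (y - 417 / 1000) ^+ 2 / 64).
Proof.
move=> y1 s1; rewrite opprD expRD; apply: ler_wpM2l; first exact: expR_ge0.
have p1 : pos_part (y - 417 / 1000) <= 7 / 12 by apply: pos_part_le; lra.
have p2 : pos_part (y - 417 / 1000) ^+ 2 <= 49 / 144.
  by have := pos_part_ge0 (y - 417 / 1000); nra.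
rewrite expRN invf_ple ?posrE ?expR_gt0//; last by lra.
apply: (@le_trans _ _ (1 + s / 2)); last exact: expR_ge1Dx.
rewrite -[leLHS]mul1r ler_pdivrMr; last by lra.
nra.
Qed.

End OneWayMass.

Section Main.
Context {R : realType} {I J : finType} {T : nat} (W : adwords R I J T).
Context {d : measure_display} {Omega : measurableType d} {P : probability Omega R}.
Variables (rnd : randomness W P) (ord : seq J) (mu : 'I_T -> I -> J -> R).
Hypothesis ord_agents : perm_eq ord (enum J).
Hypothesis mu_ge0 : forall t i j, 0 <= mu t i j.
Hypothesis mu_feasible : lp_feasible rnd (fun t i j => arrival_rate W t i * mu t i j).
Variable j : J.

Local Notation outcome := (option (I * (agent J * agent J))).
Local Notation f := (arrival_rate W).
Local Notation beta := (bid_ratio W j).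
Local Notation law := (arrival_outcome_law rnd ord mu).

Lemma sum_mu_le1 t i : f t i != 0 -> \sum_j' mu t i j' <= 1.
Proof.
move=> f0; have [h _ _] := mu_feasible; have := h t i.
rewrite -mulr_sumr -[leRHS]mulr1 ler_pM2l//.
by rewrite lt_neqAle eq_sym f0 arrival_rate_ge0.
Qed.

Lemma mu_le1 t i : f t i != 0 -> mu t i j <= 1.
Proof.
move=> /sum_mu_le1; apply: le_trans; rewrite (bigD1 j)//= lerDl sumr_ge0//.
Qed.

Lemma sum_law t (h : outcome -> R) : \sum_q law t q * h q =
  law t None * h None + \sum_i f t i * \sum_aa agents_law rnd ord mu t i aa * h (Some (i, aa)).
Proof.
rewrite (bigD1 None)//=; congr (_ + _).
rewrite (reindex_omap Some id)/=; last by case.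
rewrite (eq_bigl predT); last by move=> a; rewrite eqxx.
rewrite sum_pair; apply: eq_bigr => i _; rewrite mulr_sumr.
by apply: eq_bigr => aa _ /=; rewrite mulrA.
Qed.

Lemma sum_agents_halves t i : f t i != 0 ->
  \sum_aa agents_law rnd ord mu t i aa * ((aa.1 == Some j)%:R + (aa.2 == Some j)%:R) =
  2 * mu t i j.
Proof.
move=> /sum_mu_le1 mu1.
have marginal (B : pred (agent J * agent J)) :
    (\sum_(aa | B aa) agents_law rnd ord mu t i aa)%:E =
    (2%:E * lebesgue_measure ([set e | B (agents_at ord mu t i e)] `&` half_interval))%E.
  rewrite -(probability_finite P (measurable_agents_preimage rnd ord_agents mu_ge0 t i) B).
  rewrite -(eta_law rnd t)//.
  rewrite (_ : mkset _ = \bigcup_(aa in [set` B]) [set e | agents_at ord mu t i e = aa]).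
    apply: fin_bigcup_measurable; first exact: finite_finset.
    by move=> aa _; exact: measurable_agents_at.
  by apply/seteqP; split=> [e Be|e [aa Baa /= ->]]//=; exists (agents_at ord mu t i e).
apply: EFin_inj; rewrite -(agents_at_halves ord_agents mu_ge0 j mu1).
rewrite (_ : \sum_aa _ = \sum_(aa | aa.1 == Some j) agents_law rnd ord mu t i aa +
   \sum_(aa | aa.2 == Some j) agents_law rnd ord mu t i aa).
  rewrite EFinD !marginal;
  congr (2%:E * lebesgue_measure (_ `&` _) + 2%:E * lebesgue_measure (_ `&` _))%E;
  by apply/seteqP; split=> e /= /eqP.
rewrite [in RHS]big_mkcond/= [X in _ + X]big_mkcond/= -big_split/=.
by apply: eq_bigr => aa _; do 2 case: (_ == _); rewrite /= ?mulr0 ?mulrDr ?mulr1 ?mulr0.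
Qed.

Lemma load_atE t : load_at beta j law t = \sum_i f t i * beta i * mu t i j.
Proof.
rewrite /load_at sum_law /expected_frac /= !mulr0 add0r.
apply: eq_bigr => i _; have [->|f0] := eqVneq (f t i) 0; first by rewrite !mul0r.
rewrite (_ : \sum_aa _ = \sum_aa agents_law rnd ord mu t i aa *
    ((aa.1 == Some j)%:R + (aa.2 == Some j)%:R) * (beta i / 2)).
  by rewrite -mulr_suml sum_agents_halves//; field.
by apply: eq_bigr => -[a a'] _ /=; field.
Qed.

Lemma one_way_large_le t : \sum_q law t q * one_way_large beta j q <=
  \sum_(i | (2 / 3 <= beta i) && (1 / 2 < mu t i j)) f t i * beta i * (2 * mu t i j - 1).
Proof.
rewrite sum_law /= mulr0 add0r [leRHS]big_mkcond/=; apply: ler_sum => i _.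
have b0 := bid_ratio_ge0 W j i.
have [->|f0] := eqVneq (f t i) 0; first by rewrite !mul0r if_same.
rewrite (bigD1 (Some j, Some j))//= big1 ?addr0; last first.
  move=> [a a']; rewrite xpair_eqE /= => /negbTE naa.
  by rewrite andbA naa mulr0.
rewrite !eqxx /=; case: ifP => _ /=; last by rewrite !mulr0.
have hl : agents_law rnd ord mu t i (Some j, Some j) <= Num.max (2 * mu t i j - 1) 0.
  rewrite -lee_fin /agents_law fineK; last first.
    by rewrite fin_num_measure//; exact: measurable_agents_preimage.
  rewrite (eta_law rnd t); last exact: measurable_agents_at.
  by apply: agents_at_both => //; exact: sum_mu_le1.
have := ler_wpM2l (mulr_ge0 (arrival_rate_ge0 W t i) b0) hl.
rewrite maxEle subr_le0; case: ltP => hmu.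
  by case: ifP => [?|_]; lra.
by case: ifP => [_|/negbT]; rewrite -?ltNge => *; lra.
Qed.

Section Shortfall.
Variable S : {set 'I_T * I}.

Definition in_S (t : 'I_T) (o : outcome * (bool * bool)) : bool :=
  if o.1 is Some (i, _) then (t, i) \in S else false.

Definition bid_in_S (t : 'I_T) (o : outcome * (bool * bool)) : R :=
  if o.1 is Some (i, _) then if (t, i) \in S then beta i else 0 else 0.

Local Notation short := (shortfall (outcome_law law) bid_in_S (enum 'I_T) 0).

Lemma sum_outcome_law t (h : outcome -> R) :
  \sum_o outcome_law law t o * h o.1 = \sum_q law t q * h q.
Proof.
rewrite sum_pair; apply: eq_bigr => q _.
by rewrite sum_pair !big_bool /outcome_law /=; field.
Qed.

Lemma outcome_law_ge0 t o : 0 <= outcome_law law t o.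
Proof. by rewrite divr_ge0// arrival_outcome_law_ge0. Qed.

Lemma outcome_law_sum1 t : \sum_o outcome_law law t o = 1.
Proof.
rewrite -(arrival_outcome_law_sum1 rnd ord_agents mu_ge0 t).
have := sum_outcome_law t (fun=> 1).
by under eq_bigr do rewrite mulr1; under [in RHS]eq_bigr do rewrite mulr1.
Qed.

Lemma bid_in_S01 t o : 0 <= bid_in_S t o <= 1.
Proof.
rewrite /bid_in_S; case: o.1 => [[i _]|]; rewrite ?lexx ?ler01//.
by case: ifP; rewrite ?lexx ?ler01// bid_ratio_ge0 bid_ratio_le1.
Qed.

Lemma capped_bidE w : capped_bid rnd j S w =
  Num.min (Num.max (foldl (fun A t => A + bid_in_S t (run_outcomes rnd ord mu w t))
                      0 (enum 'I_T)) 0) 1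
    * budget W j.
Proof.
have B0 := budget_gt0 W j.
have foldl_sum s A : foldl (fun A t => A + bid_in_S t (run_outcomes rnd ord mu w t)) A s =
    A + \sum_(t <- s) bid_in_S t (run_outcomes rnd ord mu w t).
  elim: s A => [|t s ih] A /=; first by rewrite big_nil addr0.
  by rewrite ih big_cons addrA.
rewrite foldl_sum add0r big_enum/=.
set A := \sum_t _.
have -> : Num.max A 0 = A.
  apply/max_idPl; apply: sumr_ge0 => t _.
  by case/andP: (bid_in_S01 t (run_outcomes rnd ord mu w t)).
rewrite minr_pMl ?ltW// mul1r /capped_bid; congr Num.min.
rewrite big_mkcond sum_pair mulr_suml; apply: eq_bigr => t _ /=.
rewrite /bid_in_S ffunE /= /arrival_outcome /arrives.
case: (arrival rnd t w) => [i|] /=; last by rewrite mul0r big1// => i _; rewrite mul0r if_same.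
rewrite (bigD1 i)//= big1 ?addr0 => [|i' i'i]; last first.
  by rewrite (inj_eq Some_inj) eq_sym (negbTE i'i) mul0r if_same.
rewrite eqxx mul1r; case: ifP => _; last by rewrite mul0r.
by rewrite /bid_ratio divfK// gt_eqF.
Qed.

Lemma expectation_capped_bid :
  expected_value rnd j S = ((1 - short) * budget W j)%:E.
Proof.
have B0 := budget_gt0 W j.
rewrite /expected_value.
pose F (A : R) := Num.min (Num.max A 0) 1 * budget W j.
have -> : capped_bid rnd j S = (fun w => F
   (foldl (fun A t => A + bid_in_S t (run_outcomes rnd ord mu w t)) 0 (enum 'I_T))).
  by apply/funext => w; exact: capped_bidE.
transitivity (iter_exp (outcome_law law) (fun t A o => A + bid_in_S t o) F (enum 'I_T) 0)%:E.
  apply: (expectation_run rnd ord_agents mu_ge0 (fun t A o => A + bid_in_S t o)) => A.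
  by rewrite /F mulr_ge0 ?(ltW B0)// le_min ler01 le_max lexx orbT.
congr EFin; rewrite /shortfall.
have : (0 : R) <= 0 by [].
move: {2 3 4}(0 : R); elim: (enum _) => [|t ts ih] A A0 /=.
  rewrite /F /pos_part; congr (_ * _).
  by rewrite !maxEle !minEle; do ?case: ifPn; rewrite -?ltNge => *; lra.
rewrite -[X in X - _](outcome_law_sum1 t) -sumrB mulr_suml; apply: eq_bigr => o _.
rewrite ih; first by ring.
by rewrite addr_ge0//; case/andP: (bid_in_S01 t o).
Qed.

Lemma lp_mass_le :
  \sum_t \sum_(i | (t, i) \in S) f t i * beta i * mu t i j <= 1 - short.
Proof.
have [_ /(_ j S) + _] := mu_feasible; rewrite expectation_capped_bid lee_fin.
have B0 := budget_gt0 W j.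
rewrite -ler_pdivrMr//; apply: le_trans; rewrite le_eqVlt; apply/orP; left; apply/eqP.
rewrite mulr_suml [RHS]big_mkcond sum_pair; apply: eq_bigr => t _.
rewrite [LHS]big_mkcond; apply: eq_bigr => i _ /=; case: ifP => // _.
by rewrite /bid_ratio; field; rewrite gt_eqF.
Qed.

Lemma short_ge :
  \prod_t (1 - \sum_(i | (t, i) \in S) f t i) *
    (1 + \sum_t \sum_(i | (t, i) \in S) f t i -
     \sum_t \sum_(i | (t, i) \in S) f t i * beta i) <= short.
Proof.
have nhit t o : ~~ in_S t o -> bid_in_S t o = 0.
  by rewrite /in_S /bid_in_S; case: o.1 => [[i _]|] // /negbTE ->.
have := shortfall_ge outcome_law_ge0 outcome_law_sum1 nhit bid_in_S01 (enum 'I_T).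
have hitE t : \sum_(o | in_S t o) outcome_law law t o = \sum_(i | (t, i) \in S) f t i.
  have := sum_outcome_law t (fun q => if q is Some (i, _) then ((t, i) \in S)%:R else 0).
  rewrite sum_law /= mulr0 add0r => h.
  rewrite big_mkcond [RHS]big_mkcond/=; transitivity (\sum_o outcome_law law t o * (in_S t o)%:R).
    by apply: eq_bigr => o _; case: ifP; rewrite ?mulr1 ?mulr0.
  transitivity (\sum_o outcome_law law t o * (if o.1 is Some (i, _) then ((t, i) \in S)%:R else 0)).
    by apply: eq_bigr => o _; rewrite /in_S; case: o.1 => [[? ?]|].
  rewrite h; apply: eq_bigr => i _; rewrite -mulr_suml agents_law_sum1// mul1r.
  by case: ifP; rewrite ?mulr1 ?mulr0.
have meanE t : \sum_o outcome_law law t o * bid_in_S t o =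
    \sum_(i | (t, i) \in S) f t i * beta i.
  have := sum_outcome_law t
    (fun q => if q is Some (i, _) then if (t, i) \in S then beta i else 0 else 0).
  rewrite sum_law /= mulr0 add0r => ->.
  rewrite [RHS]big_mkcond/=; apply: eq_bigr => i _; rewrite -mulr_suml agents_law_sum1// mul1r.
  by case: ifP; rewrite ?mulr0.
rewrite !big_enum/=.
under eq_bigr do rewrite hitE.
under [X in _ + X - _ ]eq_bigr do rewrite hitE.
by under [X in _ - X ]eq_bigr do rewrite meanE.
Qed.

End Shortfall.

Lemma sum_load_at : \sum_(t <- enum 'I_T) load_at beta j law t = load W mu j.
Proof.
rewrite big_enum/=; apply: eq_bigr => t _; rewrite load_atE; apply: eq_bigr => i _.
by rewrite /bid_ratio; field; rewrite gt_eqF// budget_gt0.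
Qed.

Lemma load_le1 : load W mu j <= 1.
Proof.
pose S : {set 'I_T * I} := finset xpredT; have := lp_mass_le S.
have : 0 <= shortfall (outcome_law law) (bid_in_S S) (enum 'I_T) 0.
  by apply: shortfall_ge0; exact: outcome_law_ge0.
have -> : load W mu j = \sum_t \sum_(i | (t, i) \in S) f t i * beta i * mu t i j.
  rewrite -sum_load_at big_enum/=; apply: eq_bigr => t _; rewrite load_atE.
  by apply: eq_bigl => i; rewrite finset.in_set.
lra.
Qed.

Lemma one_way_large_sum_le : \sum_(t <- enum 'I_T) load_at beta j law t ^+ 2 <= 1 / 93 ->
  \sum_(t <- enum 'I_T) \sum_q law t q * one_way_large beta j q <= 417 / 1000.
Proof.
rewrite !big_enum/= => l2.
pose S : {set 'I_T * I} :=
  finset (fun ti => (2 / 3 <= beta ti.2) && (1 / 2 < mu ti.1 ti.2 j)).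
have f0 t i : 0 <= f t i by exact: arrival_rate_ge0.
have b0 i : 0 <= beta i := bid_ratio_ge0 W j i.
have b1 i : beta i <= 1 := bid_ratio_le1 W j i.
pose F t := \sum_(i | (t, i) \in S) f t i.
pose Y t := \sum_(i | (t, i) \in S) f t i * beta i.
pose M t := \sum_(i | (t, i) \in S) f t i * beta i * mu t i j.
apply: (@le_trans _ _ (2 * \sum_t M t - \sum_t Y t)).
  rewrite mulr_sumr -sumrB; apply: ler_sum => t _.
  apply: le_trans (one_way_large_le t) _.
  rewrite /M /Y mulr_sumr -sumrB le_eqVlt; apply/orP; left; apply/eqP.
  by apply: eq_big => [i|i _]; [rewrite finset.in_set|ring].
apply: (@one_way_mass_le _ _ F Y M (load_at beta j law) _ _ _ _ _ l2 (short_ge S) (lp_mass_le S)).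
- by move=> t; exact: sumr_ge0.
- move=> t; rewrite /F /Y mulr_sumr; apply/andP; split; apply: ler_sum => i.
    by rewrite finset.in_set /= => /andP[h _]; rewrite mulrC ler_wpM2l.
  by move=> _; rewrite ler_piMr.
- move=> t; rewrite /M /Y mulr_suml; apply/andP; split; apply: ler_sum => i.
    rewrite finset.in_set /= => /andP[_ h]; apply: ler_wpM2l; [exact: mulr_ge0|lra].
  move=> _; have [->|fi] := eqVneq (f t i) 0; first by rewrite !mul0r.
  by apply: ler_piMr; [exact: mulr_ge0|exact: mu_le1].
- move=> t; rewrite load_atE /M big_mkcond/=; apply: ler_sum => i _.
  by case: ifP => // _; apply: mulr_ge0 => //; exact: mulr_ge0.
Qed.

End Main.

Theorem theorem5p4 (R : realType) (I J : finType) (T : nat)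
    (W : adwords R I J T)
    (d : measure_display) (Omega : measurableType d)
    (P : probability Omega R) (rnd : randomness W P)
    (ord : seq J) (ord_agents : perm_eq ord (enum J))
    (mu : 'I_T -> I -> J -> R)
    (mu_ge0 : forall t i j, 0 <= mu t i j)
    (mu_feasible :
       lp_feasible rnd (fun t i j => arrival_rate W t i * mu t i j))
    (j : J) :
  ('E_P[fun w => pos_part (1 - allocated_bid rnd ord mu j w / budget W j)]
     <= (g (load W mu j))%:E)%E.
Proof.
rewrite (expectation_shortfall rnd ord_agents mu_ge0) lee_fin.
have y1 := load_le1 ord_agents mu_ge0 mu_feasible j.
apply: le_trans (g_lower_bound y1).
have b0 := bid_ratio_ge0 W j; have b1 := bid_ratio_le1 W j.
have marks := marks_at_agent W j.
have law0 := arrival_outcome_law_ge0 rnd ord mu.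
have law1 := arrival_outcome_law_sum1 rnd ord_agents mu_ge0.
have sumE := sum_load_at ord_agents mu_ge0 mu_feasible j.
set l := load_at (bid_ratio W j) j (arrival_outcome_law rnd ord mu) in sumE.
have [l2|l2] := leP (\sum_(t <- enum 'I_T) l t ^+ 2) (1 / 93).
  rewrite -sumE; apply: value_le_of_one_way => //; first by rewrite sumE.
  exact: one_way_large_sum_le l2.
apply: le_trans (value_le_expR_square b0 b1 marks law0 law1 _) _.
rewrite -/l sumE -mulr_suml; apply: expR_square_le => //; exact: ltW.
Qed.
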